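(* If a sequence (indexed by $n\ge1$) of $\mathrm{ARW}(K_n,\lambda_n,\nu_n)$ chains exhibits total-variation cutoff, then it also exhibits separation cutoff.
   Context: For each $n$, $V_n$ is a finite non-empty set and the parameters satisfy the following standing assumptions (index $n$ dropped). $K\colon V^2\to[0,1]$ is a sub-stochastic matrix ($\sum_{y\in V}K(x,y)\le 1$) that is non-degenerate (no principal sub-matrix of $K$ is stochastic). A $K$-walk is the killed random walk which, when alive at $x$, jumps to $y\in V$ at rate $K(x,y)$ and is killed at rate $1-\sum_{y}K(x,y)$. $\lambda\in(0,\infty)$. $\nu$ is a probability distribution on $V$ whose support intersects every connected component of $K$, so that every site has a positive probability of being visited by a $K$-walk started from $\nu$. ARW dynamics: a configuration is $\eta\in\{0,\mathrm s,1,2,\ldots\}^V$; the site $x$ is empty if $\eta(x)=0$, holds one sleeping particle if $\eta(x)=\mathrm s$, and holds $k\ge1$ active particles if $\eta(x)=k$. In continuous time, active particles perform independent $K$-walks (a killed particle is removed), but fall asleep at rate $\lambda$ when alone on a site; sleeping particles do not move, but become active upon contact with another particle. Configurations in $\{0,\mathrm s\}^V$ are stable, and from any configuration with finitely many particles the process is almost surely absorbed in a stable configuration. The $\mathrm{ARW}(K,\lambda,\nu)$ chain is the discrete-time Markov chain on $\mathcal X=\{0,\mathrm s\}^V$ which at each step adds one active particle to the current state at an independent $\nu$-distributed random site and then runs the ARW dynamics until a stable configuration is obtained; the latter is the new state. Its transition matrix $P$ is irreducible and aperiodic, with unique invariant distribution $\pi$. $d_{\mathrm{sep}}(t):=\max_{\eta,\eta'\in\mathcal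 X}\big(1-\frac{P^t(\eta,\eta')}{\pi(\eta')}\big)$ and $t_{\mathrm{sep}}:=\inf\{t\in\mathbb N\colon d_{\mathrm{sep}}(t)\le1/2\}$; $d_{\mathrm{tv}}(t):=\max_{\eta\in\mathcal X,A\subseteq\mathcal X}|P^t(\eta,A)-\pi(A)|$ and $t_{\mathrm{mix}}:=\min\{t\in\mathbb N\colon d_{\mathrm{tv}}(t)\le1/2\}$; here $\mathbb N=\{0,1,2,\dots\}$. A sequence of chains exhibits separation cutoff if for any fixed $\alpha\ge0$, $d_{\mathrm{sep}}^{(n)}(\lfloor\alpha t_{\mathrm{sep}}^{(n)}\rfloor)$ tends, as $n\to\infty$, to $1$ if $\alpha<1$ and to $0$ if $\alpha>1$. It exhibits total-variation cutoff if the same holds with $d_{\mathrm{tv}}^{(n)},t_{\mathrm{mix}}^{(n)}$ in place of $d_{\mathrm{sep}}^{(n)},t_{\mathrm{sep}}^{(n)}$. *)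

(* Defs.v *)
(* MathComp / MathComp-Analysis. *)
From HB Require Import structures.
From mathcomp Require Import all_boot all_order all_algebra.
From mathcomp Require Import all_classical all_reals all_analysis.
Set Implicit Arguments.
Unset Strict Implicit.
Unset Printing Implicit Defensive.
Import Order.TTheory GRing.Theory Num.Theory.
Import numFieldNormedType.Exports.
Local Open Scope classical_set_scope.
Local Open Scope ring_scope.

Section FiniteChains.
Variables (R : realType) (X : finType).
Implicit Types (P : X -> X -> R) (m : X -> R) (d : nat -> R).

Fixpoint mpow P (t : nat) (x y : X) : R :=
  if t is t'.+1 then \sum_z P x z * mpow P t' z y else (x == y)%:R.

Definition invariant_distribution P m : Prop :=
  [/\ forall x, 0 <= m x, \sum_x m x = 1
    & forall y, \sum_x m x * P x y = m y].

(* The base value 0 of the two maxima is harmless: total-variation terms are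
   nonnegative, and since P^t(x,.) and m both have total mass 1, some y has
   1 - P^t(x,y) / m(y) >= 0. *)
Definition d_sep P m (t : nat) : R :=
  \big[Num.max/0]_(p : X * X) (1 - mpow P t p.1 p.2 / m p.2).

Definition d_tv P m (t : nat) : R :=
  \big[Num.max/0]_(p : X * {set X})
    `| \sum_(y in p.2) mpow P t p.1 y - \sum_(y in p.2) m y |.

(* The least t with d t <= 1/2; the default 0 is used only if there is none. *)
Definition half_time d : nat :=
  if pselect (exists t, d t <= 2^-1) is left ex then ex_minn ex else 0%N.

End FiniteChains.

(* d n t is the distance to equilibrium of the n-th chain at time t. *)
Definition cutoff (R : realType) (d : nat -> nat -> R) : Prop :=
  forall alpha : R, 0 <= alpha ->
    (alpha < 1 ->
       d n (Num.truncn (alpha * (half_time (d n))%:R)) @[n --> \oo] --> (1 : R))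
    /\
    (1 < alpha ->
       d n (Num.truncn (alpha * (half_time (d n))%:R)) @[n --> \oo] --> (0 : R)).

(* K is not assumed symmetric, so the condition on the support of nu is stated
   as: every site is reached with positive probability by a K-walk from nu.
   When K x y > 0 <-> K y x > 0, this says exactly that the support meets every
   connected component of K; in general it is implied by meeting every strongly
   connected component, and implies meeting every weakly connected one. *)
Record arw_params (R : realType) := ArwParams {
  site : finType;
  walk : site -> site -> R;
  sleep_rate : R;
  source : site -> R;
  site_nonempty : (0 < #|site|)%N;
  walk_bounds : forall x y, 0 <= walk x y <= 1;
  walk_substochastic : forall x, \sum_y walk x y <= 1;
  walk_nondegenerate : forall A : {set site}, A != finset.set0 ->
    ~ (forall x, x \in A -> \sum_(y in A) walk x y = 1);
  sleep_rate_gt0 : 0 < sleep_rate;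
  source_ge0 : forall x, 0 <= source x;
  source_sum1 : \sum_x source x = 1;
  source_reaches : forall y, exists2 x, 0 < source x
    & connect [rel a b | 0 < walk a b] x y }.

Section ActivatedRandomWalk.
Variables (R : realType) (A : arw_params R).
Local Notation V := (site A).
Local Notation K := (@walk R A).

(* None is one sleeping particle, Some k is k active particles. *)
Definition config := {ffun V -> option nat}.

(* {0,s}^V, with true standing for s. *)
Definition stable_config := {ffun V -> bool}.

Definition of_stable (xi : stable_config) : config :=
  [ffun x => if xi x then None else Some 0%N].

Definition active (eta : config) (x : V) : nat := odflt 0%N (eta x).

Definition set_site (eta : config) (x : V) (s : option nat) : config :=
  [ffun z => if z == x then s else eta z].

(* A sleeping particle met by an active one wakes up, whence two active ones. *)
Definition add_active (eta : config) (x : V) : config :=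
  set_site eta x (if eta x is Some k then Some k.+1 else Some 2%N).

Definition remove_active (eta : config) (x : V) : config :=
  set_site eta x (Some (active eta x).-1).

(* The generator of the continuous-time dynamics; the summands of sites without
   active particles vanish. *)
Definition arw_generator (f : config -> R) (eta : config) : R :=
  \sum_x ((active eta x)%:R *
      (\sum_y K x y * (f (add_active (remove_active eta x) y) - f eta)
       + (1 - \sum_y K x y) * (f (remove_active eta x) - f eta))
    + (eta x == Some 1%N)%:R *
      (sleep_rate A * (f (set_site eta x None) - f eta))).

(* The probability of being in eta' at time t when started from eta, i.e.
   (exp (t L) 1_{eta'}) (eta) for L the generator. The number of particles never
   increases, so only finitely many configurations are involved and the
   exponential series converges. *)
Definition arw_transition (t : R) (eta eta' : config) : R :=
  limn (series (fun k => t ^+ k / k`!%:R *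
    iter k arw_generator (fun zeta => (zeta == eta')%:R) eta)).

(* The probability of being absorbed in xi; stable configurations are
   absorbing. *)
Definition stabilisation (eta : config) (xi : stable_config) : R :=
  lim (arw_transition t eta (of_stable xi) @[t --> +oo]).

Definition arw_matrix (eta eta' : stable_config) : R :=
  \sum_x source x * stabilisation (add_active (of_stable eta) x) eta'.

End ActivatedRandomWalk.

(* Main.v *)
Require Import Defs.
From HB Require Import structures.
From mathcomp Require Import all_boot all_order all_algebra.
From mathcomp Require Import all_classical all_reals all_analysis.
From mathcomp Require Import ring lra zify.
Set Implicit Arguments.
Unset Strict Implicit.
Unset Printing Implicit Defensive.
Import Order.TTheory GRing.Theory Num.Theory.
Import numFieldNormedType.Exports.
Local Open Scope classical_set_scope.
Local Open Scope ring_scope.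

(* By the abelian property, sites may be toppled in any order without changing
   the law of the final state. Release the particles one after the other and let
   each walk until it finds a site where no earlier one has stopped (internal
   DLA); those that stopped are active, so sleep instructions are ignored on the
   way. At the time T when V is filled, stabilising yields exactly the stationary
   law whatever the initial state was, while from the empty state the full one
   cannot be reached before T; hence d_sep(t) = P(T > t).
   Let 1/L be the smallest probability, over all sites, that a walk visits the
   site. Removing one site from the initial set increases the mean filling time
   by at most L, since the two fillings can be coupled with one discrepancy; so
   Var T <= (L - 1) mu, where mu = E T. By Chebyshev, separation cutoff holds as
   soon as (L - 1) / mu -> 0. Finally P(T > t) >= (1 - 1/L)^t, and since
   2 d_tv(s) contracts oscillations this rate passes to total variation:
   2 d_tv(t) >= (1 - 1/L)^t. Taking t = 2 t_mix <= 6 mu, total-variation cutoff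
   forces (L - 1) / mu -> 0. *)

(** * Exponential averages of convergent sequences *)

Lemma cvg_sum_finite (R : realType) (I : Type) (r : seq I) (P : pred I)
    (T : Type) (F : set_system T) {FF : Filter F} (f : I -> T -> R) (g : I -> R) :
  (forall i, P i -> f i x @[x --> F] --> g i) ->
  \sum_(i <- r | P i) f i x @[x --> F] --> \sum_(i <- r | P i) g i.
Proof. by move=> fg; apply: cvg_big => //; exact: add_continuous. Qed.

Section CauchyProduct.
Variables (R : realType) (u v : nat -> R).

Lemma series_convolution n :
  series (fun k => \sum_(j < k.+1) u j * v (k - j)%N) n =
  \sum_(i < n) u i * series v (n - i)%N.
Proof.
elim: n => [|n IH]; first by rewrite /series /= big_geq // big_ord0.
rewrite seriesSr IH [RHS]big_ord_recr /= big_ord_recr /=.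
rewrite addrA -big_split /= subSnn subnn; congr (_ + _).
  by apply: eq_bigr => i _; rewrite -mulrDr (subSn (ltnW (ltn_ord i))) seriesSr.
by rewrite /series /= big_nat1.
Qed.

Lemma norm_series_sub m n : (m <= n)%N ->
  `|series v n - series v m| <= [normed series v] n - [normed series v] m.
Proof.
by move=> mn; rewrite !sub_series_geq //; exact: ler_norm_sum.
Qed.

Lemma cauchy_product :
  cvgn [normed series u] -> cvgn [normed series v] ->
  series (fun k => \sum_(j < k.+1) u j * v (k - j)%N) @ \oo -->
    limn (series u) * limn (series v).
Proof.
move=> cu cv; set c := fun k => _.
pose AU := [normed series u]; pose AV := [normed series v].
have AUV0 (w : nat -> R) n : 0 <= [normed series w] n by rewrite /=; apply: sumr_ge0.
have ndA (w : nat -> R) : {homo [normed series w] : a b / (a <= b)%N >-> a <= b}.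
  exact: (@nondecreasing_series R (fun i => `|w i|) xpredT 0%N (fun _ _ _ => normr_ge0 _)).
have bnd n : `|series c n - series u n * series v n| <=
    AU n * AV n - AU n./2 * AV n./2.
  rewrite distrC series_convolution {1}/series /= big_mkord mulr_suml -sumrB.
  have le1 : `|\sum_(i < n) (u i * series v n - u i * series v (n - i)%N)| <=
      \sum_(i < n) `|u i| * (AV n - AV (n - i)%N).
    apply: le_trans (ler_norm_sum _ _ _) _; apply: ler_sum => i _.
    by rewrite -mulrBr normrM ler_wpM2l // norm_series_sub ?leq_subr.
  apply: le_trans le1 _; under eq_bigr do rewrite mulrBr.
  have AUE m : AU m = \sum_(i < m) `|u i| by rewrite /AU /normed_series_of /series /= big_mkord.
  rewrite sumrB -mulr_suml !AUE lerD2l lerN2 mulr_suml.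
  have hn : (n./2 <= n)%N by lia.
  rewrite (big_ord_widen n (fun i => `|u i| * AV n./2)) //.
  rewrite big_mkcond; apply: ler_sum => i _; case: ifP => [ih|_].
    by rewrite ler_wpM2l // ndA //; lia.
  by rewrite mulr_ge0 // AUV0.
have half_oo : (fun n => n./2) @ \oo --> \oo.
  apply/cvgnyPge => m; exists m.*2 => // n /= mn.
  by rewrite -(doubleK m) half_leq.
have cAUV : (fun n => AU n * AV n) @ \oo --> limn AU * limn AV by exact: cvgM.
have cd : (fun n => AU n * AV n - AU n./2 * AV n./2) @ \oo --> (0 : R).
  rewrite -(subrr (limn AU * limn AV)); apply: cvgB => //.
  exact: (cvg_comp _ _ half_oo cAUV).
have cUV : (fun n => series u n * series v n) @ \oo -->
    limn (series u) * limn (series v).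
  by apply: cvgM; exact: normed_cvg.
have c0 : (fun n => series c n - series u n * series v n) @ \oo --> (0 : R).
  apply/cvgr0Pnorm_le => e e0; have /cvgr0Pnorm_le /(_ _ e0) := cd.
  by apply: filterS => n; apply: le_trans; apply: le_trans (bnd n) (ler_norm _).
rewrite -[X in _ --> X](add0r) (_ : series c =
  fun n => (series c n - series u n * series v n) + series u n * series v n).
  exact: cvgD.
by apply/funext => n; rewrite subrK.
Qed.

End CauchyProduct.

Section ExponentialMean.
Variable R : realType.
Implicit Types (t M l : R) (a : nat -> R).

Lemma exp_coeff_le t k : 0 < t -> expR (- t) * exp_coeff t k <= k.+1%:R / t.
Proof.
move=> t0; have h := expR_ge1Dxn k (ltW t0).
have e : exp_coeff t k * t = k.+1%:R * (t ^+ k.+1 / k.+1`!%:R).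
  rewrite /exp_coeff /= exprSr factS natrM; field.
  by rewrite nat1r !pnatr_eq0 /= -lt0n fact_gt0.
rewrite ler_pdivlMr // -mulrA e expRN ler_pdivrMl ?expR_gt0 // mulrC.
by rewrite ler_wpM2r // (le_trans _ h) // lerDr ler01.
Qed.

Lemma cvg_exp_coeff_pinfty k :
  expR (- t) * exp_coeff t k @[t --> +oo] --> (0 : R).
Proof.
apply/cvgr0Pnorm_le => e e0; near=> t.
have t0 : 0 < t by near: t; apply: nbhs_pinfty_gt; rewrite num_real.
have c0 := exp_coeff_ge0 k (ltW t0).
rewrite ger0_norm; last by rewrite mulr_ge0 // expR_ge0.
apply: le_trans (exp_coeff_le _ t0) _; rewrite ler_pdivrMr // mulrC.
by rewrite -ler_pdivrMr //; near: t; apply: nbhs_pinfty_ge; rewrite num_real.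
Unshelve. all: by end_near. Qed.

Lemma is_cvg_exp_bounded a M t : (forall k, `|a k| <= M) ->
  cvgn [normed series (fun k => exp_coeff t k * a k)].
Proof.
move=> aM; have M0 : 0 <= M by exact: le_trans (normr_ge0 _) (aM 0%N).
apply: (@series_le_cvg _ (fun k => `|exp_coeff t k * a k|)
  (fun k => M * exp_coeff `|t| k)) => [n|n|n|].
- exact: normr_ge0.
- by rewrite mulr_ge0 // exp_coeff_ge0.
- rewrite normrM mulrC; apply: ler_pM => //.
  by rewrite /exp_coeff /= normrM normfV normrX (@ger0_norm _ _%:R).
- by apply: is_cvg_seriesZ; exact: is_cvg_series_exp_coeff.
Qed.

Lemma cvg_exp_mean a M l : (forall k, `|a k| <= M) -> a @ \oo --> l ->
  expR (- t) * limn (series (fun k => exp_coeff t k * a k)) @[t --> +oo] --> l.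
Proof.
move=> aM al; have M0 : 0 <= M by exact: le_trans (normr_ge0 _) (aM 0%N).
have lM : `|l| <= M.
  have cn : (fun k => `|a k|) @ \oo --> `|l| by exact: cvg_norm.
  rewrite -(cvg_lim (@norm_hausdorff _ _) cn); apply: limr_le.
    by apply/cvg_ex; exists `|l|.
  by exists 0%N => // n _ /=.
have bM k : `|a k - l| <= M + M.
  by apply: le_trans (ler_normB _ _) _; exact: lerD.
apply/cvgrPdist_le => e e0.
have e2 : 0 < e / 2 by lra.
have /cvgrPdist_le /(_ _ e2) [K _ hK] := al.
pose g t := \sum_(k < K) (expR (- t) * exp_coeff t k) * (M + M).
have cg : g t @[t --> +oo] --> (0 : R).
  have z0 : \sum_(k < K) 0 * (M + M) = 0 :> R.
    by rewrite big1 // => i _; rewrite mul0r.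
  rewrite -{}z0; apply: cvg_sum_finite => i _.
  apply: cvgM; last exact: cvg_cst.
  exact: cvg_exp_coeff_pinfty.
have /cvgr0Pnorm_le /(_ _ e2) hg := cg.
near=> t; have t0 : 0 < t by near: t; apply: nbhs_pinfty_gt; rewrite num_real.
have c0 k := exp_coeff_ge0 k (ltW t0).
have gt : g t <= e / 2.
  by apply: le_trans (ler_norm _) _; near: t.
have cl : cvgn (series (fun k => exp_coeff t k * l)).
  by apply: normed_cvg; apply: (@is_cvg_exp_bounded (fun=> l) M).
have ca : cvgn (series (fun k => exp_coeff t k * a k)).
  by apply: normed_cvg; exact: is_cvg_exp_bounded aM.
have ce := is_cvg_series_exp_coeff t.
have -> : l = expR (- t) * limn (series (fun k => exp_coeff t k * l)).
  rewrite (_ : (fun k => _) = l *: exp_coeff t); last first.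
    by apply/funext => k; rewrite mulrC.
  by rewrite lim_seriesZ // -/(expR t) mulrCA expRN mulVf ?mulr1 // gt_eqF ?expR_gt0.
rewrite -mulrBr -lim_seriesB // normrM ger0_norm ?expR_ge0 //.
have cn : cvgn [normed series (fun k => exp_coeff t k * (l - a k))].
  by apply: (@is_cvg_exp_bounded _ (M + M)) => k; rewrite distrC.
have eqd : (fun k => exp_coeff t k * l) - (fun k => exp_coeff t k * a k) =
    (fun k => exp_coeff t k * (l - a k)) by apply/funext => k; rewrite mulrBr.
rewrite eqd.
apply: le_trans (ler_wpM2l (expR_ge0 _) (lim_series_norm cn)) _.
rewrite mulrC -ler_pdivlMr ?expR_gt0 // -expRN opprK.
apply: limr_le => //; exists 0%N => // n _ /=.
apply: le_trans (_ : \sum_(0 <= k < n) exp_coeff t k * ((k < K)%:R * (M + M) + e / 2) <= _).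
  apply: ler_sum => k _; rewrite normrM (ger0_norm (c0 k)) ler_wpM2l //.
  have [kK|Kk] := ltnP k K.
    by rewrite mul1r distrC (le_trans (bM k)) // lerDl ltW.
  by rewrite mul0r add0r; exact: hK.
under eq_bigr do rewrite mulrDr; rewrite big_split /=.
have -> : e * expR t = e / 2 * expR t + e / 2 * expR t by lra.
apply: lerD.
  apply: le_trans (_ : \sum_(k < K) exp_coeff t k * (M + M) <= _).
    rewrite big_mkord; under eq_bigr do rewrite mulrCA mulr_natl mulrb.
    have F0 k : 0 <= exp_coeff t k * (M + M) by rewrite mulr_ge0 ?addr_ge0.
    rewrite -big_mkcond.
    rewrite (big_ord_widen_cond (n + K) (fun k => (k < K)%N)
      (fun k => exp_coeff t k * (M + M))) ?leq_addr //.
    rewrite (big_ord_widen (n + K) (fun k => exp_coeff t k * (M + M))) ?leq_addl //.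
    rewrite [leLHS]big_mkcond [leRHS]big_mkcond; apply: ler_sum => i _ /=.
    by case: (i < K)%N; case: (i < n)%N => //=; exact: F0.
  apply: le_trans (_ : expR t * g t <= _); last first.
    by rewrite mulrC ler_pM2r ?expR_gt0.
  rewrite /g mulr_sumr; apply: ler_sum => k _.
  by rewrite !mulrA -expRD subrr expR0 mul1r.
rewrite -mulr_suml mulrC ler_wpM2l ?(ltW e2) //.
apply: nondecreasing_cvgn_le ce n.
exact: (@nondecreasing_series R _ xpredT 0%N (fun k _ _ => c0 k)).
Unshelve. all: by end_near. Qed.

End ExponentialMean.

(* Applied to z k j = (W - 1)^k W^j f, for W the transition operator of the
   uniformised chain. *)
Section Uniformisation.
Variables (R : realType) (z : nat -> nat -> R).
Hypothesis zS : forall k j, z k j.+1 = z k j + z k.+1 j.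

Lemma newton_forward n k : z k n = \sum_(j < n.+1) 'C(n, j)%:R * z (k + j)%N 0%N.
Proof.
elim: n k => [|n IH] k.
  by rewrite big_ord_recl big_ord0 addr0 bin0 mul1r addn0.
rewrite zS !IH [RHS]big_ord_recl /= bin0 mul1r addn0.
under [X in _ = _ + X]eq_bigr do
  rewrite /bump leq0n add1n binS natrD mulrDl addnS -addSn.
rewrite big_split /= addrA; congr (_ + _).
rewrite big_ord_recl /= bin0 mul1r addn0; congr (_ + _).
rewrite [RHS]big_ord_recr /= bin_small // mul0r addr0.
by apply: eq_bigr => i _; rewrite /bump leq0n add1n addSnnS.
Qed.

Variables (M l : R).
Hypothesis zM : forall j, `|z 0 j| <= M.
Hypothesis zl : z 0%N @ \oo --> l.

Lemma norm_difference_le k j : `|z k j| <= 2 ^+ k * M.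
Proof.
elim: k j => [|k IH] j; first by rewrite expr0 mul1r.
have -> : z k.+1 j = z k j.+1 - z k j by rewrite zS; ring.
apply: le_trans (ler_normB _ _) _; rewrite exprS -mulrA mulr_natl mulr2n.
exact: lerD.
Qed.

Lemma cvg_uniformisation (c : R) : 0 < c ->
  limn (series (fun k => exp_coeff (c * t) k * z k 0%N)) @[t --> +oo] --> l.
Proof.
move=> c0.
have key t : expR (- t) * limn (series (fun k => exp_coeff t k * z 0%N k)) =
    limn (series (fun k => exp_coeff t k * z k 0%N)).
  have cz : cvgn [normed series (fun k => exp_coeff t k * z k 0%N)].
    apply: (@series_le_cvg _ (fun k => `|exp_coeff t k * z k 0%N|)
      (fun k => M * exp_coeff (2 * `|t|) k)) => [n|n|n|].
    - exact: normr_ge0.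
    - rewrite mulr_ge0 ?exp_coeff_ge0 ?mulr_ge0 //.
      exact: le_trans (normr_ge0 _) (zM 0%N).
    - rewrite normrM /exp_coeff /= normrM normfV normrX (@ger0_norm _ n`!%:R) //.
      have -> : M * ((2 * `|t|) ^+ n / n`!%:R) = `|t| ^+ n / n`!%:R * (2 ^+ n * M).
        by rewrite exprMn !mulrA; ring.
      by rewrite ler_wpM2l ?divr_ge0 ?exprn_ge0 // norm_difference_le.
    - by apply: is_cvg_seriesZ; exact: is_cvg_series_exp_coeff.
  have ce : cvgn [normed series (exp_coeff t)].
    rewrite normed_series_exp_coeff; exact: is_cvg_series_exp_coeff.
  have := cauchy_product cz ce.
  rewrite (_ : (fun k => \sum_(j < k.+1) _) = fun k => exp_coeff t k * z 0%N k).
    move=> h; rewrite (cvg_lim (@norm_hausdorff _ _) h) -/(expR t).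
    by rewrite mulrC -mulrA -expRD subrr expR0 mulr1.
  apply/funext => k; rewrite newton_forward mulr_sumr.
  apply: eq_bigr => -[j /=]; rewrite ltnS => jk _; rewrite add0n.
  rewrite mulrAC [RHS]mulrA; congr (_ * _).
  have e : t ^+ k = t ^+ j * t ^+ (k - j) by rewrite -exprD subnKC.
  rewrite /exp_coeff /= e.
  have -> : 'C(k, j)%:R = k`!%:R / (j`!%:R * (k - j)`!%:R) :> R.
    by rewrite -(bin_fact jk) natrM natrM mulfK // mulf_neq0 // pnatr_eq0 -lt0n fact_gt0.
  by field; rewrite !pnatr_eq0 -!lt0n !fact_gt0.
under eq_cvg do rewrite -key.
have h : c * t @[t --> +oo] --> +oo by apply: gt0_cvgMry => //; exact: cvg_id.
exact: cvg_comp h (cvg_exp_mean zM zl).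
Qed.

End Uniformisation.

(** * Topplings *)

Lemma big_option (R : Type) (idx : R) (op : Monoid.com_law idx) (T : finType)
    (F : option T -> R) :
  \big[op/idx]_i F i = op (F None) (\big[op/idx]_x F (Some x)).
Proof.
rewrite (bigD1 None) //=; congr (op _ _).
rewrite (reindex_omap Some id) /=; last by case.
by apply: eq_bigl => x; rewrite eqxx.
Qed.

Section Instructions.
Variables (R : realType) (A : arw_params R).
Local Notation V := (site A).
Local Notation K := (@walk R A).
Local Notation lam := (sleep_rate A).
Implicit Types (eta zeta : config A) (x y z : V) (xi : stable_config A)
  (f g : config A -> R).

Definition instruction : finType := option (option V).

Definition add1 (s : option nat) := if s is Some k then Some k.+1 else Some 2%N.
Definition remove1 (s : option nat) := Some (odflt 0%N s).-1.
Definition doze1 (s : option nat) := if s == Some 1%N then None else s.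

Definition update (g : option nat -> option nat) x eta : config A :=
  [ffun z => if z == x then g (eta z) else eta z].

(* Some (Some y) is a jump to y, Some None a killing, None a sleep instruction,
   the latter being without effect unless the particle is alone. *)
Definition follow x (i : instruction) eta : config A :=
  match i with
  | Some (Some y) => add_active (remove_active eta x) y
  | Some None => remove_active eta x
  | None => update doze1 x eta
  end.

Definition weight x (i : instruction) : R :=
  match i with
  | Some (Some y) => K x y / (1 + lam)
  | Some None => (1 - \sum_y K x y) / (1 + lam)
  | None => lam / (1 + lam)
  end.

Definition topple x f eta : R :=
  if active eta x == 0%N then f eta else \sum_i weight x i * f (follow x i eta).

Lemma add_activeE eta x : add_active eta x = update add1 x eta.
Proof. by apply/ffunP => z; rewrite !ffunE; case: eqP => // ->. Qed.

Lemma remove_activeE eta x : remove_active eta x = update remove1 x eta.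
Proof. by apply/ffunP => z; rewrite !ffunE; case: eqP => // ->. Qed.

Lemma updateC (g h : option nat -> option nat) x y eta : x != y ->
  update g x (update h y eta) = update h y (update g x eta).
Proof.
move=> xy; apply/ffunP => z; rewrite !ffunE.
by have [->|_] := eqVneq z x; rewrite ?(negPf xy).
Qed.

Lemma update_add_comm (g : option nat -> option nat) x y eta :
  (x = y -> g (add1 (eta x)) = add1 (g (eta x))) ->
  update g x (update add1 y eta) = update add1 y (update g x eta).
Proof.
have [<-|xy] := eqVneq x y; last by move=> _; exact: updateC.
move=> /(_ erefl) h; apply/ffunP => z; rewrite !ffunE.
by have [->|//] := eqVneq z x.
Qed.

Lemma active_update (g : option nat -> option nat) x y eta : x != y ->
  active (update g y eta) x = active eta x.
Proof. by move=> xy; rewrite /active ffunE (negPf xy). Qed.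

Lemma active_add_active eta x y : (0 < active eta x)%N ->
  (0 < active (add_active eta y) x)%N.
Proof.
rewrite add_activeE /active ffunE; have [->|//] := eqVneq x y.
by case: (eta y).
Qed.

Lemma active_add_active_same eta x : (0 < active (add_active eta x) x)%N.
Proof. by rewrite add_activeE /active ffunE eqxx; case: (eta x). Qed.

Lemma follow_add x i eta y : (0 < active eta x)%N ->
  follow x i (add_active eta y) = add_active (follow x i eta) y.
Proof.
move=> ax; case: i => [[z|]|] /=.
- rewrite !add_activeE !remove_activeE update_add_comm.
    have [->|zy] := eqVneq z y; first by [].
    by rewrite updateC.
  by move=> _; move: ax; rewrite /active; case: (eta x) => [[|k]|].
- rewrite !add_activeE !remove_activeE update_add_comm //.
  by move=> _; move: ax; rewrite /active; case: (eta x) => [[|k]|].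
- rewrite !add_activeE update_add_comm //.
  by move=> _; move: ax; rewrite /active; case: (eta x) => [[|[|k]]|].
Qed.

Lemma follow_update x i eta y (g : option nat -> option nat) :
  x != y -> g (add1 (eta y)) = add1 (g (eta y)) ->
  follow x i (update g y eta) = update g y (follow x i eta).
Proof.
move=> xy gy; case: i => [[z|]|] /=.
- rewrite !add_activeE !remove_activeE [update remove1 x _]updateC //.
  rewrite [RHS]update_add_comm // => _.
  by rewrite ffunE eq_sym (negPf xy).
- by rewrite !remove_activeE updateC.
- by rewrite updateC.
Qed.

Lemma follow_comm x i y j eta : x != y ->
  (0 < active eta x)%N -> (0 < active eta y)%N ->
  follow x i (follow y j eta) = follow y j (follow x i eta).
Proof.
move=> xy ax ay; case: j => [[w|]|] /=.
- rewrite follow_add ?remove_activeE ?active_update //.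
  rewrite follow_update //.
  by move: ay; rewrite /active; case: (eta y) => [[|k]|].
- rewrite !remove_activeE follow_update //.
  by move: ay; rewrite /active; case: (eta y) => [[|k]|].
- rewrite follow_update //.
  by move: ay; rewrite /active; case: (eta y) => [[|[|k]]|].
Qed.

Lemma active_follow x i y eta : x != y -> (0 < active eta y)%N ->
  (0 < active (follow x i eta) y)%N.
Proof.
rewrite eq_sym => xy ay; case: i => [[z|]|] /=.
- by rewrite active_add_active ?remove_activeE ?active_update.
- by rewrite remove_activeE active_update.
- by rewrite active_update.
Qed.

Lemma weight_ge0 x i : 0 <= weight x i.
Proof.
have l0 := sleep_rate_gt0 A.
have l1 : 0 <= 1 + lam by rewrite addr_ge0 // ltW.
case: i => [[y|]|] /=; rewrite divr_ge0 //.
- by case/andP: (walk_bounds x y).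
- by rewrite subr_ge0 walk_substochastic.
- exact: ltW.
Qed.

Lemma weight_sum1 x : \sum_i weight x i = 1.
Proof.
have l0 := sleep_rate_gt0 A.
rewrite !big_option /= -mulr_suml; field.
by rewrite gt_eqF // addr_gt0.
Qed.

Lemma arw_generatorE f eta : arw_generator f eta =
  (1 + lam) * \sum_x (active eta x)%:R * (topple x f eta - f eta).
Proof.
have l0 := sleep_rate_gt0 A.
rewrite /arw_generator mulr_sumr; apply: eq_bigr => x _; rewrite /topple.
have [ax|ax] := eqVneq (active eta x) 0%N.
  rewrite ax subrr !mulr0 mul0r add0r.
  case: eqP => [h|_]; last by rewrite mul0r.
  by move: ax; rewrite /active h.
have -> : (eta x == Some 1%N)%:R * (lam * (f (set_site eta x None) - f eta)) =
    (active eta x)%:R * (lam * (f (update doze1 x eta) - f eta)).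
  case: eqP => [h|h].
    rewrite /active h; congr (_ * (_ * (f _ - _))).
    by apply/ffunP => z; rewrite !ffunE; case: eqP => // ->; rewrite h.
  rewrite mul0r (_ : update doze1 x eta = eta) ?subrr ?mulr0 //.
  apply/ffunP => z; rewrite ffunE; case: eqP => // ->.
  by rewrite /doze1; case: eqP.
rewrite !big_option /= -mulrDr mulrCA; congr (_ * _).
have -> : \sum_y K x y * (f (add_active (remove_active eta x) y) - f eta) =
    \sum_y K x y * f (add_active (remove_active eta x) y) - (\sum_y K x y) * f eta.
  by rewrite mulr_suml -sumrB; apply: eq_bigr => y _; rewrite mulrBr.
under [\sum_y K x y / _ * _]eq_bigr do rewrite mulrAC.
rewrite -mulr_suml; field.
by rewrite gt_eqF // addr_gt0.
Qed.

Lemma topple_mono x f g eta :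
  (forall i, (0 < active eta x)%N -> f (follow x i eta) <= g (follow x i eta)) ->
  f eta <= g eta -> topple x f eta <= topple x g eta.
Proof.
move=> fg0 fg; rewrite /topple; case: (posnP (active eta x)) => // ax.
by apply: ler_sum => i _; rewrite ler_wpM2l ?weight_ge0 ?fg0.
Qed.

Lemma topple_linear x f (a : R) g eta :
  topple x (fun zeta => f zeta + a * g zeta) eta =
  topple x f eta + a * topple x g eta.
Proof.
rewrite /topple; case: eqP => // _; rewrite mulr_sumr -big_split.
by apply: eq_bigr => i _; rewrite mulrDr mulrCA.
Qed.

Lemma topple_cst x (a : R) eta : topple x (fun=> a) eta = a.
Proof. by rewrite /topple -mulr_suml weight_sum1 mul1r; case: eqP. Qed.

Lemma toppleC x y f eta : (0 < active eta x)%N -> (0 < active eta y)%N ->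
  topple x (topple y f) eta = topple y (topple x f) eta.
Proof.
have [->//|xy] := eqVneq x y => ax ay.
rewrite {1 3}/topple !gtn_eqF //.
transitivity (\sum_i \sum_j weight x i * (weight y j * f (follow y j (follow x i eta)))).
  apply: eq_bigr => i _; rewrite /topple gtn_eqF ?active_follow //.
  by rewrite mulr_sumr.
rewrite exchange_big; apply: eq_bigr => j _ /=.
rewrite /topple gtn_eqF ?active_follow 1?eq_sym // mulr_sumr.
by apply: eq_bigr => i _; rewrite mulrCA follow_comm // eq_sym.
Qed.

Lemma cvg_topple x (f : nat -> config A -> R) g eta :
  (forall i, (0 < active eta x)%N -> f n (follow x i eta) @[n --> \oo] --> g (follow x i eta)) ->
  f n eta @[n --> \oo] --> g eta ->
  topple x (f n) eta @[n --> \oo] --> topple x g eta.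
Proof.
move=> fg0 fg; rewrite /topple; case: (posnP (active eta x)) => // ax.
apply: cvg_sum_finite => i _; apply: cvgM; first exact: cvg_cst.
exact: fg0.
Qed.

Lemma active_of_stable xi x : active (of_stable xi) x = 0%N.
Proof. by rewrite /active ffunE; case: (xi x). Qed.

Lemma topple_stable x f xi : topple x f (of_stable xi) = f (of_stable xi).
Proof. by rewrite /topple active_of_stable. Qed.

Lemma inactive_stable eta : (forall x, active eta x = 0%N) ->
  exists xi, eta = of_stable xi.
Proof.
move=> a0; exists [ffun x => eta x == None]; apply/ffunP => x.
by rewrite !ffunE; move: (a0 x); rewrite /active; case: (eta x) => //= k ->.
Qed.

Lemma of_stable_inj : injective (@of_stable R A).
Proof.
move=> xi xi' /ffunP e; apply/ffunP => x; have := e x; rewrite !ffunE.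
by case: (xi x); case: (xi' x).
Qed.

End Instructions.

Section Absorption.
Variables (R : realType) (A : arw_params R).
Local Notation V := (site A).
Local Notation K := (@walk R A).
Local Notation lam := (sleep_rate A).
Implicit Types (eta zeta : config A) (x y z : V) (xi : stable_config A)
  (f g : config A -> R).

Definition occupancy (s : option nat) : nat := odflt 1%N s.
Definition total eta : nat := \sum_x occupancy (eta x).

Lemma total_update (g : option nat -> option nat) x eta :
  (total (update g x eta) + occupancy (eta x) = total eta + occupancy (g (eta x)))%N.
Proof.
rewrite /total (bigD1 x) //= [in RHS](bigD1 x) //= ffunE eqxx.
have -> : (\sum_(i | i != x) occupancy (update g x eta i) =
    \sum_(i | i != x) occupancy (eta i))%N.
  by apply: eq_bigr => i /negPf ix; rewrite ffunE ix.
by lia.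
Qed.

Lemma total_add_active eta x : total (add_active eta x) = (total eta).+1.
Proof.
rewrite add_activeE; have := total_update add1 x eta.
by case: (eta x) => [k|] /=; lia.
Qed.

Lemma total_remove_active eta x : (0 < active eta x)%N ->
  (total (remove_active eta x)).+1 = total eta.
Proof.
rewrite remove_activeE; have := total_update remove1 x eta.
by rewrite /active; case: (eta x) => [[|k]|] //=; lia.
Qed.

Lemma total_follow x i eta : (0 < active eta x)%N ->
  (total (follow x i eta) <= total eta)%N.
Proof.
move=> ax; have := total_remove_active ax; case: i => [[y|]|] /=.
- by rewrite total_add_active; lia.
- by lia.
- have := total_update doze1 x eta.
  by case: (eta x) => [[|[|k]]|] //=; lia.
Qed.

Lemma active_le_total eta : (\sum_x active eta x <= total eta)%N.
Proof. by apply: leq_sum => x _; rewrite /active; case: (eta x). Qed.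

Lemma killed_reachable x : exists2 y, connect [rel a b | 0 < K a b] x y
  & \sum_z K y z < 1.
Proof.
pose B := [set y | connect [rel a b | 0 < K a b] x y]%SET.
have B0 : B != finset.set0.
  by apply/set0Pn; exists x; rewrite inE connect0.
case: (pickP [pred y | (y \in B) && (\sum_z K y z < 1)]) => [y /= /andP[]|none].
  by rewrite inE => xy ly; exists y.
exfalso; apply: (walk_nondegenerate B0) => y yB.
have := none y; rewrite /= yB /= => /negbT; rewrite -leNgt => ge1.
have e : \sum_z K y z = 1.
  by apply/eqP; rewrite eq_le ge1 walk_substochastic.
rewrite -[RHS]e [RHS](bigID [pred z | z \in B]) /= [X in _ = _ + X]big1 ?addr0 //.
move=> z zB; apply/eqP; rewrite eq_le; case/andP: (walk_bounds y z) => -> _.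
rewrite andbT leNgt; apply: contra zB => yz; move: yB; rewrite !inE => xy.
exact: connect_trans xy (connect1 _).
Qed.

Section Closed.
Variable P : config A -> Prop.
Hypothesis Pfollow : forall x i eta, P eta -> (0 < active eta x)%N ->
  0 < weight x i -> P (follow x i eta).

Let lam1_gt0 : 0 < 1 + lam.
Proof. by rewrite addr_gt0 ?sleep_rate_gt0. Qed.

Lemma closed_walk x y eta : connect [rel a b | 0 < K a b] x y ->
  P eta -> (0 < active eta x)%N ->
  exists zeta, [/\ P zeta, (0 < active zeta y)%N & total zeta = total eta].
Proof.
case/connectP => p; elim: p x eta => [|z p IH] x eta /=.
  by move=> _ -> Pe ae; exists eta.
case/andP=> xz pz yl Pe ae.
have w0 : 0 < weight x (Some (Some z)) by rewrite /= divr_gt0.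
have [|zeta [? ? tz]] := IH z _ pz yl (Pfollow Pe ae w0).
  exact: active_add_active_same.
by exists zeta; split=> //; rewrite tz /= total_add_active total_remove_active.
Qed.

Lemma closed_stable eta : P eta -> exists xi, P (of_stable xi).
Proof.
have [n] := ubnP (total eta); elim: n eta => // n IH eta; rewrite ltnS => tn Pe.
case: (pickP [pred x | (0 < active eta x)%N]) => [x /= ax|none].
  have [y xy ky] := killed_reachable x.
  have [zeta [Pz az tz]] := closed_walk xy Pe ax.
  have w0 : 0 < weight y (Some None) by rewrite /= divr_gt0 // subr_gt0.
  apply: (IH _ _ (Pfollow Pz az w0)) => /=.
  by rewrite total_remove_active // tz.
have [|xi e] := @inactive_stable _ _ eta; last by exists xi; rewrite -e.
by move=> x; have := none x; rewrite /=; case: (active eta x).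
Qed.

Lemma closed_kill eta x : (forall z, eta z != None) ->
  P (add_active eta x) -> P eta.
Proof.
move=> e0; have [y /connectP[p pp yl] ky] := killed_reachable x.
have remK z : remove_active (add_active eta z) z = eta.
  rewrite remove_activeE add_activeE; apply/ffunP => w; rewrite !ffunE.
  by case: eqP => // ->; have := e0 z; case: (eta z).
elim: p x pp yl => [|z p IH] x /=.
  move=> _ yx Pa; rewrite -(remK x).
  apply: (Pfollow (i := Some None) Pa); first exact: active_add_active_same.
  by rewrite /= divr_gt0 // subr_gt0 -yx.
case/andP=> xz pz yl Pa; apply: (IH z pz yl).
rewrite -[in add_active eta z](remK x).
apply: (Pfollow (i := Some (Some z)) Pa); first exact: active_add_active_same.
by rewrite /= divr_gt0.
Qed.

End Closed.

Lemma generator_harmonic_le0 N g :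
  (forall eta, (total eta <= N)%N -> arw_generator g eta = 0) ->
  (forall xi, (total (of_stable xi) <= N)%N -> g (of_stable xi) = 0) ->
  forall eta, (total eta <= N)%N -> g eta <= 0.
Proof.
move=> g0 gs eta0 t0; rewrite leNgt; apply/negP => gpos.
pose D : finType := {ffun V -> option 'I_N.+1}.
pose emb (c : D) : config A := [ffun x => omap (@nat_of_ord _) (c x)].
have embP eta : (total eta <= N)%N -> exists c, eta = emb c.
  move=> te; exists [ffun x => omap inord (eta x)]; apply/ffunP => x.
  rewrite !ffunE; case ex : (eta x) => [k|] //=; rewrite inordK // ltnS.
  by apply: leq_trans te; rewrite /total (bigD1 x) //= ex leq_addr.
have [c0 ec0] := embP _ t0.
have Pc0 : (total (emb c0) <= N)%N by rewrite -ec0.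
case: (@arg_maxP _ _ _ c0 [pred c | (total (emb c) <= N)%N] (fun c => g (emb c)) Pc0).
move=> c /= tc cmax; set M := g (emb c) in cmax.
have gM eta : (total eta <= N)%N -> g eta <= M.
  by move=> te; have [c' e] := embP _ te; rewrite e cmax // -e.
have M0 : 0 < M by apply: lt_le_trans gpos (gM _ t0).
pose P eta := (total eta <= N)%N /\ g eta = M.
suff Pf x i eta : P eta -> (0 < active eta x)%N -> 0 < weight x i ->
    P (follow x i eta).
  have [|xi [txi gxi]] := closed_stable Pf (eta := emb c); first by split.
  by move: M0; rewrite -gxi gs // ltxx.
move=> [te ge] ax wx; have tf := leq_trans (total_follow _ ax) te.
split; first exact: tf.
have tle y : topple y g eta <= M.
  rewrite /topple; case: (posnP (active eta y)) => [_|ay]; first by rewrite ge.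
  rewrite -[M]mul1r -(weight_sum1 y) mulr_suml; apply: ler_sum => j _.
  by rewrite ler_wpM2l ?weight_ge0 // gM // (leq_trans (total_follow _ ay)).
have e1 : \sum_y (active eta y)%:R * (M - topple y g eta) = 0.
  have := g0 _ te; rewrite arw_generatorE => /eqP; rewrite mulf_eq0 gt_eqF /=; last first.
    by rewrite addr_gt0 ?sleep_rate_gt0.
  move=> /eqP /(congr1 -%R); rewrite oppr0 -sumrN => {2}<-.
  by apply: eq_bigr => y _; rewrite ge -mulrN opprB.
have e2 : topple x g eta = M.
  have /eqP := e1; rewrite psumr_eq0 => [|y _]; last by rewrite mulr_ge0 // subr_ge0.
  move=> /allP /(_ x (mem_index_enum x)) /=.
  by rewrite mulf_eq0 pnatr_eq0 gtn_eqF //= subr_eq0 => /eqP.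
have e3 : \sum_j weight x j * (M - g (follow x j eta)) = 0.
  move: e2; rewrite /topple gtn_eqF // => e2.
  under eq_bigr do rewrite mulrBr.
  by rewrite sumrB e2 -mulr_suml weight_sum1 mul1r subrr.
have /eqP := e3; rewrite psumr_eq0 => [|j _]; last first.
  by rewrite mulr_ge0 ?weight_ge0 // subr_ge0 gM // (leq_trans (total_follow _ ax)).
move=> /allP /(_ i (mem_index_enum i)) /=.
by rewrite mulf_eq0 gt_eqF //= subr_eq0 => /eqP.
Qed.

Lemma arw_generator_linear f (a : R) g eta :
  arw_generator (fun zeta => f zeta + a * g zeta) eta =
  arw_generator f eta + a * arw_generator g eta.
Proof.
rewrite !arw_generatorE mulrCA -mulrDr; congr (_ * _).
rewrite mulr_sumr -big_split; apply: eq_bigr => x _ /=.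
by rewrite topple_linear; ring.
Qed.

Lemma generator_harmonic_eq N f g :
  (forall eta, (total eta <= N)%N -> arw_generator f eta = 0) ->
  (forall eta, (total eta <= N)%N -> arw_generator g eta = 0) ->
  (forall xi, (total (of_stable xi) <= N)%N -> f (of_stable xi) = g (of_stable xi)) ->
  forall eta, (total eta <= N)%N -> f eta = g eta.
Proof.
move=> f0 g0 fg eta te; apply/eqP; rewrite eq_le -subr_le0 -[X in _ && X]subr_le0.
have H f' g' : (forall eta, (total eta <= N)%N -> arw_generator f' eta = 0) ->
    (forall eta, (total eta <= N)%N -> arw_generator g' eta = 0) ->
    (forall xi, (total (of_stable xi) <= N)%N -> f' (of_stable xi) = g' (of_stable xi)) ->
    f' eta - g' eta <= 0.
  move=> f0' g0' fg'; rewrite -mulN1r.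
  apply: (@generator_harmonic_le0 N (fun zeta => f' zeta + -1 * g' zeta)) => //.
    by move=> zeta tz; rewrite arw_generator_linear f0' // g0' // mulr0 addr0.
  by move=> xi txi; rewrite fg' // mulN1r subrr.
by rewrite !H // => xi txi; rewrite fg.
Qed.

End Absorption.

(** * The abelian property *)

Section Abelian.
Variables (R : realType) (A : arw_params R).
Local Notation V := (site A).
Local Notation lam := (sleep_rate A).
Implicit Types (eta zeta : config A) (x y z : V) (xi : stable_config A)
  (f g : config A -> R).

Definition rising f := forall x eta, f eta <= topple x f eta.

(* Where both sites are active the two topplings commute; where x is not, it is
   enough that toppling z does not decrease f. *)
Lemma topple_rising x f : rising f -> rising (topple x f).
Proof.
move=> rf z eta; have [az|az] := posnP (active eta z).
  by rewrite [leRHS]/topple az eqxx.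
have [ax|ax] := posnP (active eta x).
  rewrite [leLHS]/topple ax eqxx; apply: le_trans (rf z eta) _.
  by apply: topple_mono => [i _|]; exact: rf.
rewrite toppleC //; apply: topple_mono => [i _|]; exact: rf.
Qed.

Definition sweep (s : seq V) f : config A -> R := foldr (@topple R A) f s.

Lemma sweep_rising s f : rising f -> rising (sweep s f).
Proof. by move=> rf; elim: s => //= x s; exact: topple_rising. Qed.

Lemma le_sweep s f eta : rising f -> f eta <= sweep s f eta.
Proof.
move=> rf; elim: s => //= x s IH.
by apply: le_trans IH _; exact: sweep_rising.
Qed.

Lemma topple_le_sweep x s f eta : rising f -> x \in s ->
  topple x f eta <= sweep s f eta.
Proof.
move=> rf; elim: s => //= y s IH; rewrite inE => /predU1P[->|xs].
  by apply: topple_mono => [i _|]; exact: le_sweep.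
by apply: le_trans (IH xs) _; exact: sweep_rising.
Qed.

Lemma sweep_le1 s f : (forall eta, f eta <= 1) -> forall eta, sweep s f eta <= 1.
Proof.
move=> f1; elim: s => //= x s IH eta.
by rewrite -(topple_cst x 1 eta); apply: topple_mono => [i _|]; exact: IH.
Qed.

Lemma sweep_stable s f xi : sweep s f (of_stable xi) = f (of_stable xi).
Proof. by elim: s => //= x s IH; rewrite topple_stable. Qed.

(* The limit of repeated sweeps over all sites: a toppling is dominated by a
   sweep, so none of them increases the limit. *)
Lemma rising_limit f : rising f -> (forall eta, f eta <= 1) ->
  exists s : config A -> R, [/\ forall x eta, topple x s eta = s eta,
    forall eta, f eta <= s eta
    & forall xi, s (of_stable xi) = f (of_stable xi)].
Proof.
move=> rf f1; pose T n := iter n (sweep (enum V)) f.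
have rT n : rising (T n) by elim: n => //= n; exact: sweep_rising.
have T1 n eta : T n eta <= 1 by elim: n eta => //= n IH; exact: sweep_le1.
have ndT eta : nondecreasing_seq (fun n => T n eta).
  by apply/nondecreasing_seqP => n; exact: le_sweep.
have cT eta : cvgn (fun n => T n eta).
  by apply: nondecreasing_is_cvgn => //; exists 1 => _ [n _ <-].
pose s eta := limn (fun n => T n eta).
exists s; split=> [x eta|eta|xi].
- have c1 : topple x (T n) eta @[n --> \oo] --> topple x s eta.
    by apply: cvg_topple => [i _|]; exact: cT.
  have c2 : topple x (T n) eta @[n --> \oo] --> s eta.
    apply: (@squeeze_cvgr _ _ _ _ (fun n => T n eta) (fun n => T n.+1 eta)).
    + near=> n; rewrite rT /=; apply: topple_le_sweep => //.
      by rewrite mem_enum.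
    + exact: cT.
    + by rewrite (@cvg_shiftS _ (fun n => T n eta)); exact: cT.
  exact: (cvg_unique (@norm_hausdorff _ _) c1 c2).
- exact: (nondecreasing_cvgn_le (ndT eta) (cT eta) 0%N).
- rewrite /s (_ : (fun n => T n (of_stable xi)) = fun=> f (of_stable xi)).
    exact: lim_cst.
  by apply/funext => n; elim: n => //= n IH; rewrite sweep_stable.
Unshelve. all: by end_near. Qed.

Lemma topple_invariant_generator f eta : (forall x eta, topple x f eta = f eta) ->
  arw_generator f eta = 0.
Proof.
move=> tf; rewrite arw_generatorE big1 ?mulr0 // => x _.
by rewrite tf subrr mulr0.
Qed.

Definition point xi : config A -> R := fun zeta => (zeta == of_stable xi)%:R.

Lemma point_rising xi : rising (point xi).
Proof.
move=> x eta; rewrite /topple; case: (posnP (active eta x)) => // ax.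
rewrite {1}/point; case: eqP => [e|_].
  by move: ax; rewrite e active_of_stable.
by apply: sumr_ge0 => i _; rewrite mulr_ge0 ?weight_ge0.
Qed.

Lemma point_le1 xi eta : point xi eta <= 1.
Proof. by rewrite /point; case: eqP. Qed.

Section Uniformised.
Variable N : nat.

Definition uniformised f eta : R :=
  f eta + N.+1%:R^-1 * \sum_x (active eta x)%:R * (topple x f eta - f eta).

Lemma uniformisedE f eta : uniformised f eta =
  (1 - N.+1%:R^-1 * (\sum_x active eta x)%:R) * f eta +
  N.+1%:R^-1 * \sum_x (active eta x)%:R * topple x f eta.
Proof.
have -> : \sum_x (active eta x)%:R * topple x f eta =
    \sum_x (active eta x)%:R * (topple x f eta - f eta) +
    (\sum_x active eta x)%:R * f eta.
  rewrite natr_sum mulr_suml -big_split; apply: eq_bigr => x _ /=; ring.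
by rewrite /uniformised; ring.
Qed.

Lemma uniformised_mono f g :
  (forall eta, (total eta <= N)%N -> f eta <= g eta) ->
  forall eta, (total eta <= N)%N -> uniformised f eta <= uniformised g eta.
Proof.
move=> fg eta te; rewrite !uniformisedE; apply: lerD.
  rewrite ler_wpM2l ?fg // subr_ge0 mulrC ler_pdivrMr // mul1r ler_nat.
  by rewrite (leq_trans (active_le_total eta)) // ltnW.
rewrite ler_wpM2l ?invr_ge0 //; apply: ler_sum => x _; rewrite ler_wpM2l //.
apply: topple_mono => [i ax|]; last exact: fg.
by apply: fg; rewrite (leq_trans (total_follow _ ax)).
Qed.

Let c : R := (1 + lam) * N.+1%:R.

Let c_gt0 : 0 < c.
Proof. by rewrite mulr_gt0 // addr_gt0 ?sleep_rate_gt0. Qed.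

Lemma uniformised_generator f :
  uniformised f = fun eta => f eta + c^-1 * arw_generator f eta.
Proof.
apply/funext => eta; rewrite /uniformised arw_generatorE; congr (_ + _).
rewrite mulrA; congr (_ * _); rewrite /c.
by field; rewrite nat1r pnatr_eq0 /= gt_eqF // addr_gt0 ?sleep_rate_gt0.
Qed.

Lemma iter_generator_linear k f (a : R) g :
  iter k (@arw_generator R A) (fun zeta => f zeta + a * g zeta) =
  fun eta => iter k (@arw_generator R A) f eta + a * iter k (@arw_generator R A) g eta.
Proof.
elim: k => //= k ->; apply/funext => eta; exact: arw_generator_linear.
Qed.

Lemma stabilisation_bounded xi : exists s : config A -> R, [/\
  forall eta, (total eta <= N)%N -> stabilisation eta xi = s eta,
  forall eta, (total eta <= N)%N -> arw_generator s eta = 0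
  & forall xi', (total (of_stable xi') <= N)%N ->
      s (of_stable xi') = point xi (of_stable xi')].
Proof.
pose T n := iter n uniformised (point xi).
have T1 n eta : (total eta <= N)%N -> 0 <= T n eta <= 1.
  elim: n eta => [|n IH] eta te; first by rewrite point_le1 ler0n.
  have ucst (a : R) : uniformised (fun=> a) eta = a.
    rewrite /uniformised big1 ?mulr0 ?addr0 // => x _.
    by rewrite topple_cst subrr mulr0.
  apply/andP; split.
    rewrite -[leLHS](ucst 0); apply: uniformised_mono => // zeta tz.
    by case/andP: (IH _ tz).
  rewrite -[leRHS](ucst 1); apply: uniformised_mono => // zeta tz.
  by case/andP: (IH _ tz).
have ndT eta : (total eta <= N)%N -> nondecreasing_seq (fun n => T n eta).
  move=> te; apply/nondecreasing_seqP => n; elim: n eta te => [|n IH] eta te /=.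
    rewrite /T /= /uniformised lerDl mulr_ge0 ?invr_ge0 // sumr_ge0 // => x _.
    by rewrite mulr_ge0 // subr_ge0 point_rising.
  exact: uniformised_mono.
have cT eta : (total eta <= N)%N -> cvgn (fun n => T n eta).
  move=> te; apply: nondecreasing_is_cvgn; first exact: ndT.
  by exists 1 => _ [n _ <-]; case/andP: (T1 n _ te).
pose s eta := limn (fun n => T n eta).
exists s; split=> [eta te|eta te|xi' txi'].
- pose z k j := c^-1 ^+ k * iter k (@arw_generator R A) (T j) eta.
  have zS k j : z k j.+1 = z k j + z k.+1 j.
    rewrite /z (_ : T j.+1 = uniformised (T j)) // uniformised_generator iter_generator_linear.
    by rewrite -iterSr /= exprS; ring.
  have z1 j : `|z 0%N j| <= 1.
    rewrite /z mul1r /= ger0_norm; first by case/andP: (T1 j _ te).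
    by case/andP: (T1 j _ te).
  have zl : z 0%N @ \oo --> s eta.
    rewrite (_ : z 0%N = fun n => T n eta); first exact: cT.
    by apply/funext => j; rewrite /z mul1r.
  have := cvg_uniformisation zS z1 zl c_gt0.
  rewrite (_ : (fun t => _) = fun t => arw_transition t eta (of_stable xi)).
    by move=> h; rewrite /stabilisation; apply: cvg_lim h; exact: norm_hausdorff.
  apply/funext => t; rewrite /arw_transition; congr (limn (series _)).
  apply/funext => k; rewrite /z /exp_coeff /= exprMn exprVn /T /=.
  by rewrite -/(point xi); field; rewrite expf_neq0 ?gt_eqF // pnatr_eq0 -lt0n fact_gt0.
- have e : uniformised s eta = s eta.
    have c1 : uniformised (T n) eta @[n --> \oo] --> uniformised s eta.
      rewrite /uniformised; apply: cvgD; first exact: cT.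
      apply: cvgM; first exact: cvg_cst.
      apply: cvg_sum_finite => x _; apply: cvgM; first exact: cvg_cst.
      apply: cvgB; last exact: cT.
      apply: cvg_topple => [i ax|]; last exact: cT.
      by apply: cT; rewrite (leq_trans (total_follow _ ax)).
    have c2 : uniformised (T n) eta @[n --> \oo] --> s eta.
      by rewrite (@cvg_shiftS _ (fun n => T n eta)); exact: cT.
    exact: (cvg_unique (@norm_hausdorff _ _) c1 c2).
  move: e; rewrite uniformised_generator => /eqP.
  by rewrite -[X in _ == X]addr0 (inj_eq (addrI _)) mulf_eq0 invr_eq0 gt_eqF //= => /eqP.
- rewrite /s (_ : (fun n => T n (of_stable xi')) = fun=> point xi (of_stable xi')).
    exact: lim_cst.
  apply/funext => n; elim: n => //= n; rewrite /T /= -/(T n) {1}/uniformised => ->.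
  rewrite big1 ?mulr0 ?addr0 // => x _.
  by rewrite active_of_stable mul0r.
Qed.

End Uniformised.

Lemma stabilisation_exists xi : exists s : config A -> R, [/\
  forall eta, stabilisation eta xi = s eta,
  forall x eta, topple x s eta = s eta,
  forall eta, 0 <= s eta
  & forall xi', s (of_stable xi') = (xi' == xi)%:R].
Proof.
have [s [ts ps ss]] := rising_limit (@point_rising xi) (@point_le1 xi).
exists s; split=> // [eta|eta|xi'].
- have [s' [es gs' ps']] := stabilisation_bounded (total eta) xi.
  rewrite es //; apply: (generator_harmonic_eq gs') (leqnn (total eta)) => // [zeta _|xi' txi'].
    exact: topple_invariant_generator.
  by rewrite ps' // ss.
- by apply: le_trans (ps eta).
- by rewrite ss /point (inj_eq (@of_stable_inj _ _)).
Qed.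

Lemma stabilisation_ge0 eta xi : 0 <= stabilisation eta xi.
Proof. by have [s [-> _ h _]] := stabilisation_exists xi. Qed.

Lemma stabilisation_of_stable xi xi' : stabilisation (of_stable xi) xi' = (xi == xi')%:R.
Proof. by have [s [-> _ _ ->]] := stabilisation_exists xi'. Qed.

Lemma topple_stabilisation x eta xi :
  topple x (fun zeta => stabilisation zeta xi) eta = stabilisation eta xi.
Proof.
have [s [e t _ _]] := stabilisation_exists xi.
by rewrite (_ : (fun zeta => _) = s) ?t ?e //; apply/funext.
Qed.

Lemma topple_sum (I : finType) (F : I -> config A -> R) (a : I -> R) x eta :
  topple x (fun zeta => \sum_i F i zeta * a i) eta = \sum_i topple x (F i) eta * a i.
Proof.
rewrite /topple; case: eqP => // _.
under [RHS]eq_bigr do rewrite mulr_suml.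
rewrite exchange_big; apply: eq_bigr => j _ /=; rewrite mulr_sumr.
by apply: eq_bigr => i _; rewrite mulrA.
Qed.

Lemma topple_invariant_eq f g :
  (forall x eta, topple x f eta = f eta) -> (forall x eta, topple x g eta = g eta) ->
  (forall xi, f (of_stable xi) = g (of_stable xi)) -> f =1 g.
Proof.
move=> tf tg fg eta.
by apply: (@generator_harmonic_eq _ _ (total eta)) => // *;
  exact: topple_invariant_generator.
Qed.

Lemma stabilisation_sum1 eta : \sum_xi stabilisation eta xi = 1.
Proof.
apply: (@topple_invariant_eq (fun zeta => \sum_xi stabilisation zeta xi) (fun=> 1)).
- move=> x zeta; rewrite -[RHS]mulr1 mulr_suml.
  rewrite (_ : (fun _ => _) = fun zeta => \sum_xi stabilisation zeta xi * 1).
    by rewrite topple_sum; apply: eq_bigr => xi _; rewrite topple_stabilisation.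
  by apply/funext => zeta'; apply: eq_bigr => xi _; rewrite mulr1.
- by move=> x zeta; rewrite topple_cst.
- move=> xi; rewrite (bigD1 xi) //= stabilisation_of_stable eqxx big1 ?addr0 //.
  by move=> xi' /negPf ne; rewrite stabilisation_of_stable eq_sym ne.
Qed.

Lemma stabilisation_add eta x xi : stabilisation (add_active eta x) xi =
  \sum_xi' stabilisation eta xi' * stabilisation (add_active (of_stable xi') x) xi.
Proof.
move: eta; apply: topple_invariant_eq => [y eta|y eta|xi'].
- rewrite /topple; case: (posnP (active eta y)) => // ay.
  rewrite -[RHS](topple_stabilisation y) /topple gtn_eqF ?active_add_active //.
  by apply: eq_bigr => i _; rewrite follow_add.
- by rewrite topple_sum; apply: eq_bigr => xi' _; rewrite topple_stabilisation.
- rewrite (bigD1 xi') //= stabilisation_of_stable eqxx mul1r big1 ?addr0 //.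
  by move=> xi'' /negPf ne; rewrite stabilisation_of_stable eq_sym ne mul0r.
Qed.

Lemma stabilisation_total eta xi : (total eta < total (of_stable xi))%N ->
  stabilisation eta xi = 0.
Proof.
move=> lt; apply: (@generator_harmonic_eq _ _ (total eta)
  (fun zeta => stabilisation zeta xi) (fun=> 0)) => //.
- by move=> zeta _; apply: topple_invariant_generator => x zeta'; exact: topple_stabilisation.
- by move=> zeta _; apply: topple_invariant_generator => x zeta'; exact: topple_cst.
- move=> xi' txi'; rewrite stabilisation_of_stable; case: eqP => // e.
  by move: lt; rewrite ltnNge -e txi'.
Qed.

End Abelian.

(** * Exit distributions of the killed walk *)

Section KilledWalk.
Variables (R : realType) (A : arw_params R).
Local Notation V := (site A).
Local Notation K := (@walk R A).
Implicit Types (B : {set V}) (x y z w : V) (g : V -> R).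

Let K0 x y : 0 <= K x y. Proof. by case/andP: (walk_bounds x y). Qed.

Lemma dirichlet_zero B g : (forall x, x \in B -> g x = \sum_z K x z * g z) ->
  (forall x, x \notin B -> g x = 0) -> forall x, g x = 0.
Proof.
move=> gB gnB x0.
case: (@arg_maxP _ _ _ x0 xpredT (fun x => `|g x|) isT) => xm _ maxm.
set M := `|g xm| in maxm.
have gM x : `|g x| <= M by exact: maxm.
suff M0 : M = 0 by apply/eqP; rewrite -normr_le0 -M0.
apply/eqP; rewrite -[_ == _]negbK; apply/negP => Mn0.
have Mpos : 0 < M by rewrite lt_def Mn0 normr_ge0.
pose C := [set x | `|g x| == M]%SET.
have C0 : C != finset.set0 by apply/set0Pn; exists xm; rewrite inE.
apply: (walk_nondegenerate C0) => x; rewrite inE => /eqP gx.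
have xB : x \in B.
  by apply: contraTT isT => xB; move: Mpos; rewrite -gx gnB // normr0 ltxx.
have le1 : M <= \sum_z K x z * `|g z|.
  rewrite -gx gB //; apply: le_trans (ler_norm_sum _ _ _) _.
  by apply: ler_sum => z _; rewrite normrM ger0_norm.
have le2 : \sum_z K x z * `|g z| <= (\sum_z K x z) * M.
  by rewrite mulr_suml; apply: ler_sum => z _; rewrite ler_wpM2l.
have le3 : (\sum_z K x z) * M <= M.
  by rewrite -[leRHS]mul1r ler_pM2r // walk_substochastic.
have e1 : \sum_z K x z = 1.
  have : (\sum_z K x z) * M = 1 * M.
    by apply/eqP; rewrite mul1r eq_le le3 (le_trans le1 le2).
  by move/(mulIf Mn0).
have e2 : \sum_z K x z * (M - `|g z|) = 0.
  under eq_bigr do rewrite mulrBr.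
  rewrite sumrB -mulr_suml e1 mul1r; apply/eqP; rewrite subr_eq0 eq_le le1 /=.
  exact: le_trans le2 le3.
rewrite -[RHS]e1 [RHS](bigID [pred z | z \in C]) /= [X in _ = _ + X]big1 ?addr0 // => z.
rewrite inE => gz; move/eqP: e2; rewrite psumr_eq0 => [|z' _]; last first.
  by rewrite mulr_ge0 // subr_ge0.
move/allP/(_ z (mem_index_enum z)); rewrite /= mulf_eq0 subr_eq0 [M == _]eq_sym (negPf gz).
by rewrite orbF => /eqP.
Qed.

Lemma dirichlet_uniq B (g g' : V -> R) (b : V -> R) :
  (forall x, x \in B -> g x = \sum_z K x z * g z + b x) ->
  (forall x, x \in B -> g' x = \sum_z K x z * g' z + b x) ->
  (forall x, x \notin B -> g x = g' x) -> g =1 g'.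
Proof.
move=> gB gB' gg' x; apply/eqP; rewrite -subr_eq0; apply/eqP.
apply: (@dirichlet_zero B (fun x => g x - g' x)) => {x} [x xB|x xB].
  rewrite gB // gB' // opprD addrACA subrr addr0 -sumrB.
  by apply: eq_bigr => z _; rewrite mulrBr.
by rewrite gg' // subrr.
Qed.

Definition exit_step B y g x : R :=
  if x \in B then \sum_z K x z * g z else (x == y)%:R.

(* The probability that the K-walk from x leaves B, and does so at y. *)
Definition exit B y x : R := limn (fun n => iter n (exit_step B y) (fun=> 0) x).

Lemma exit_step_mono B y g g' : (forall x, g x <= g' x) ->
  forall x, exit_step B y g x <= exit_step B y g' x.
Proof.
move=> gg' x; rewrite /exit_step; case: ifP => // _.
by apply: ler_sum => z _; rewrite ler_wpM2l.
Qed.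

Lemma exit_step_ge0 n B y x : 0 <= iter n (exit_step B y) (fun=> 0) x.
Proof.
elim: n x => //= n IH x; rewrite /exit_step; case: ifP => // _.
by apply: sumr_ge0 => z _; rewrite mulr_ge0.
Qed.

Lemma exit_step_sum_le1 n B x : \sum_y iter n (exit_step B y) (fun=> 0) x <= 1.
Proof.
elim: n x => [|n IH] x /=; first by rewrite big1.
have [xB|xB] := boolP (x \in B); last first.
  under eq_bigr do rewrite /exit_step (negPf xB).
  rewrite (bigD1 x) //= eqxx big1 ?addr0 // => y /negPf.
  by rewrite eq_sym => ->.
under eq_bigr do rewrite /exit_step xB.
rewrite exchange_big /=; apply: le_trans (walk_substochastic x).
by apply: ler_sum => z _; rewrite -mulr_sumr ler_piMr.
Qed.

Lemma cvg_exit B y x : iter n (exit_step B y) (fun=> 0) x @[n --> \oo] --> exit B y x.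
Proof.
apply: nondecreasing_is_cvgn.
  apply/nondecreasing_seqP => n; elim: n x => [|n IH] x /=.
    exact: (exit_step_ge0 1).
  exact: exit_step_mono.
exists 1 => _ [n _ <-]; apply: le_trans (exit_step_sum_le1 n B x).
by rewrite (bigD1 y) //= lerDl sumr_ge0 // => z _; exact: exit_step_ge0.
Qed.

Lemma exitE B y x : exit B y x = exit_step B y (exit B y) x.
Proof.
have := @cvg_exit B y x; rewrite -(@cvg_shiftS _ (fun n => iter n _ _ x)) => c1.
apply: (cvg_unique (@norm_hausdorff _ _) c1) => /=.
rewrite /exit_step; case: ifP => _; last exact: cvg_cst.
apply: cvg_sum_finite => z _; apply: cvgM; first exact: cvg_cst.
exact: cvg_exit.
Qed.

Lemma exit_in B y x : x \in B -> exit B y x = \sum_z K x z * exit B y z.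
Proof. by move=> xB; rewrite exitE /exit_step xB. Qed.

Lemma exit_out B y x : x \notin B -> exit B y x = (x == y)%:R.
Proof. by move=> /negPf xB; rewrite exitE /exit_step xB. Qed.

Lemma exit_ge0 B y x : 0 <= exit B y x.
Proof.
apply: limr_ge; first exact: cvg_exit.
by exists 0%N => // n _ /=; exact: exit_step_ge0.
Qed.

Lemma exit_sum_le1 B x : \sum_y exit B y x <= 1.
Proof.
have c : \sum_y iter n (exit_step B y) (fun=> 0) x @[n --> \oo] --> \sum_y exit B y x.
  by apply: cvg_sum_finite => y _; exact: cvg_exit.
rewrite -(cvg_lim (@norm_hausdorff _ _) c); apply: limr_le.
  by apply/cvg_ex; exists (\sum_y exit B y x).
by exists 0%N => // n _ /=; exact: exit_step_sum_le1.
Qed.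

Lemma exit_target_in B y x : y \in B -> exit B y x = 0.
Proof.
move=> yB; apply: (@dirichlet_zero B (exit B y)) => [z|z zB]; first exact: exit_in.
by rewrite exit_out //; case: eqP => // zy; move: zB; rewrite zy yB.
Qed.

Lemma exit_markov B w y x : w \notin B -> y != w ->
  exit (w |: B) y x = exit B y x + exit B w x * exit (w |: B) y w.
Proof.
move=> wB yw; move: x.
apply: (@dirichlet_uniq B _ _ (fun=> 0)) => x xB.
- by rewrite addr0 exit_in // inE xB orbT.
- rewrite addr0 [exit B y x]exit_in // [exit B w x]exit_in // mulr_suml -big_split.
  by apply: eq_bigr => z _ /=; rewrite mulrDr mulrA.
- rewrite [exit B y x]exit_out // [exit B w x]exit_out //.
  have [->|xw] := eqVneq x w; first by rewrite eq_sym (negPf yw) add0r mul1r.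
  by rewrite mul0r addr0 exit_out // !inE negb_or xw.
Qed.

Lemma exit_gt0 B x z : connect [rel a b | 0 < K a b] x z -> z \notin B ->
  exists2 w, w \notin B & 0 < exit B w x.
Proof.
case/connectP => p; elim: p x => [|x' p IH] x /=.
  by move=> _ -> xB; exists x => //; rewrite exit_out // eqxx.
case/andP=> xx' pp zl zB; have [xB|xB] := boolP (x \in B); last first.
  by exists x => //; rewrite exit_out // eqxx.
have [w wB w0] := IH _ pp zl zB; exists w => //; rewrite exit_in //.
rewrite (bigD1 x') //= ltr_wpDr ?mulr_gt0 //.
by apply: sumr_ge0 => z' _; rewrite mulr_ge0 // exit_ge0.
Qed.

Definition source_exit B y : R := \sum_x source x * exit B y x.

Lemma source_exit_ge0 B y : 0 <= source_exit B y.
Proof. by apply: sumr_ge0 => x _; rewrite mulr_ge0 ?source_ge0 ?exit_ge0. Qed.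

Lemma source_exit_sum_le1 B : \sum_y source_exit B y <= 1.
Proof.
rewrite exchange_big /= -[leRHS](source_sum1 A); apply: ler_sum => x _.
by rewrite -mulr_sumr ler_piMr ?source_ge0 ?exit_sum_le1.
Qed.

Lemma source_exit_in B y : y \in B -> source_exit B y = 0.
Proof. by move=> yB; rewrite /source_exit big1 // => x _; rewrite exit_target_in ?mulr0. Qed.

Lemma source_exit_markov B w y : w \notin B -> y != w ->
  source_exit (w |: B) y = source_exit B y + source_exit B w * exit (w |: B) y w.
Proof.
move=> wB yw; rewrite /source_exit mulr_suml -big_split; apply: eq_bigr => x _ /=.
by rewrite exit_markov //; ring.
Qed.

Lemma source_exit_gt0 B : B != finset.setT -> exists y, 0 < source_exit B y.
Proof.
rewrite -finset.subTset => /subsetPn[z _ zB].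
have [x x0 xz] := source_reaches z; have [w wB w0] := exit_gt0 xz zB.
exists w; rewrite /source_exit (bigD1 x) //= ltr_wpDr ?mulr_gt0 //.
by apply: sumr_ge0 => y _; rewrite mulr_ge0 ?source_ge0 ?exit_ge0.
Qed.

End KilledWalk.

(** * Internal DLA and its filling time *)

Lemma setU1_in (T : finType) (x : T) (B : {set T}) : x \in B -> x |: B = B.
Proof. by move=> xB; apply/finset.setUidPr; rewrite finset.sub1set. Qed.

Lemma card_setC_setU1 (T : finType) (x : T) (B : {set T}) : x \notin B ->
  #|~: B| = #|~: (x |: B)|.+1.
Proof.
by move=> xB; rewrite (cardsD1 x) inE xB add1n finset.setCU finset.setIC -finset.setDE.
Qed.

(* q B y is the probability that a new particle stops at y when B is filled, and
   r B w y the probability that one resuming from w does when w |: B is filled. *)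
Section Filling.
Variables (R : realType) (V : finType) (q : {set V} -> V -> R)
  (r : {set V} -> V -> V -> R).
Implicit Types (B C : {set V}) (f : {set V} -> R).
Hypothesis V_gt0 : (0 < #|V|)%N.
Hypothesis q_ge0 : forall B y, 0 <= q B y.
Hypothesis q_sum_le1 : forall B, \sum_y q B y <= 1.
Hypothesis q_in : forall B y, y \in B -> q B y = 0.
Hypothesis r_ge0 : forall B w y, 0 <= r B w y.
Hypothesis r_sum_le1 : forall B w, \sum_y r B w y <= 1.
Hypothesis q_markov : forall B w y, w \notin B -> y != w ->
  q (w |: B) y = q B y + q B w * r B w y.
Hypothesis q_gt0 : forall B, B != finset.setT -> exists y, 0 < q B y.

Definition fill f B : R := f B + \sum_y q B y * (f (y |: B) - f B).

Lemma fillE f B : fill f B = (1 - \sum_y q B y) * f B + \sum_y q B y * f (y |: B).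
Proof.
rewrite /fill mulrBl mul1r -addrA; congr (_ + _).
rewrite mulr_suml addrC -sumrB.
by apply: eq_bigr => y _; rewrite mulrBr.
Qed.

Lemma fill_mono f g B : (forall y, f (y |: B) <= g (y |: B)) -> f B <= g B ->
  fill f B <= fill g B.
Proof.
move=> fgy fg; rewrite !fillE; apply: lerD.
  by rewrite ler_wpM2l // subr_ge0.
by apply: ler_sum => y _; rewrite ler_wpM2l.
Qed.

Lemma fill_linear f (a b : R) B : fill (fun C => a + b * f C) B = a + b * fill f B.
Proof.
rewrite /fill mulrDr addrA mulr_sumr; congr (_ + _); apply: eq_bigr => y _; ring.
Qed.

Lemma fill_setT f : fill f finset.setT = f finset.setT.
Proof. by rewrite /fill big1 ?addr0 // => y _; rewrite q_in ?mul0r // inE. Qed.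

(* Coupling of the fillings from B and from w |: B: they keep differing at one
   site, unless the particle stopping at w in the first one, which walks on in
   the second, disappears. *)
Lemma fill_increment f B w : w \notin B ->
  fill f B - fill f (w |: B) =
    (1 - \sum_y q B y) * (f B - f (w |: B)) +
    q B w * (\sum_y r B w y * (f (w |: B) - f (y |: (w |: B)))) +
    \sum_(y | y != w) q B y * (f (y |: B) - f (w |: (y |: B))).
Proof.
move=> wB; rewrite /fill; set C := w |: B.
have wC : w |: C = C by rewrite /C finset.setUA finset.setUid.
have -> : \sum_y q C y * (f (y |: C) - f C) =
    \sum_(y | y != w) q B y * (f (y |: C) - f C) -
    q B w * \sum_y r B w y * (f C - f (y |: C)).
  rewrite (bigD1 w) //= wC subrr mulr0 add0r.
  rewrite [X in _ - _ * X](bigD1 w) //= wC subrr mulr0 add0r.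
  rewrite mulr_sumr -sumrB; apply: eq_bigr => y yw.
  by rewrite q_markov //; ring.
rewrite (bigD1 w) //= -/C [\sum_y q B y](bigD1 w) //=.
have -> : \sum_(y | y != w) q B y * (f (y |: B) - f (w |: (y |: B))) =
    \sum_(y | y != w) q B y * (f (y |: B) - f B) -
    \sum_(y | y != w) q B y * (f (y |: C) - f C) +
    (\sum_(y | y != w) q B y) * (f B - f C).
  rewrite mulr_suml -sumrB -big_split; apply: eq_bigr => y _ /=.
  by rewrite /C finset.setUCA; ring.
ring.
Qed.

Definition antitone f := forall B w, f (w |: B) <= f B.

Lemma antitone_subset f B C : antitone f -> B \subset C -> f C <= f B.
Proof.
move=> af; have [n] := ubnP #|C :\: B|; elim: n C => // n IH C; rewrite ltnS => cn BC.
have [e|[w wC]] := set_0Vmem (C :\: B).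
  by rewrite (_ : C = B) //; apply/eqP; rewrite finset.eqEsubset BC andbT -finset.setD_eq0 e.
move: (wC); rewrite inE => /andP[wB wC'].
rewrite -(finset.setD1K wC'); apply: le_trans (af _ _) _; apply: IH.
  move: cn; rewrite (cardsD1 w) wC add1n; apply: leq_trans.
  rewrite ltnS subset_leq_card //; apply/fintype.subsetP => z.
  by rewrite !inE => /andP[-> /andP[-> ->]].
apply/fintype.subsetP => z zB; rewrite !inE (fintype.subsetP BC _ zB) andbT.
by apply: contraNneq wB => <-.
Qed.

Lemma fill_antitone f : antitone f -> antitone (fill f).
Proof.
move=> af B w; have [wB|wB] := boolP (w \in B); first by rewrite setU1_in.
rewrite -subr_ge0 fill_increment // !addr_ge0 //.
- by rewrite mulr_ge0 // subr_ge0.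
- by rewrite mulr_ge0 // sumr_ge0 // => y _; rewrite mulr_ge0 // subr_ge0.
- by rewrite sumr_ge0 // => y _; rewrite mulr_ge0 // subr_ge0.
Qed.

(* unfilled t B is the probability that V is not filled t steps after B. *)
Definition unfilled t B : R := iter t fill (fun C => (C != finset.setT)%:R) B.

Lemma unfilledS t B : unfilled t.+1 B = fill (unfilled t) B.
Proof. by []. Qed.

Lemma unfilled_bounds t B : 0 <= unfilled t B <= 1.
Proof.
elim: t B => [|t IH] B; first by rewrite /unfilled /=; case: (B != _); rewrite ?lexx ler01.
have cst (a : R) : fill (fun=> a) B = a.
  by rewrite /fill big1 ?addr0 // => y _; rewrite subrr mulr0.
have I0 C : 0 <= unfilled t C by case/andP: (IH C).
have I1 C : unfilled t C <= 1 by case/andP: (IH C).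
apply/andP; split.
  by rewrite -[leLHS](cst 0); exact: fill_mono.
by rewrite -[leRHS](cst 1); exact: fill_mono.
Qed.

Lemma unfilled_setT t : unfilled t finset.setT = 0.
Proof.
elim: t => [|t IH]; first by rewrite /unfilled /= eqxx.
by rewrite unfilledS fill_setT.
Qed.

Lemma unfilled_antitone t : antitone (unfilled t).
Proof.
elim: t => [|t IH]; last exact: fill_antitone.
move=> B w; rewrite /unfilled /=.
case: (eqVneq B finset.setT) => [->|_]; first by rewrite finset.setUT eqxx.
by case: (_ != _).
Qed.

Lemma unfilled_one_hole t x : (1 - q (~: [set x]) x) ^+ t <= unfilled t (~: [set x]).
Proof.
elim: t => [|t IH].
  rewrite expr0 /unfilled /= (_ : (_ != _) = true) //.
  by apply/eqP => /setP/(_ x); rewrite !inE eqxx.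
rewrite unfilledS /fill (bigD1 x) //=.
rewrite finset.setUCr unfilled_setT big1 ?addr0 => [|y yx]; last first.
  by rewrite q_in ?mul0r // !inE.
rewrite sub0r mulrN -{1}[unfilled t _]mul1r -mulrBl exprS ler_wpM2l //.
rewrite subr_ge0 (le_trans _ (q_sum_le1 (~: [set x]))) //.
by rewrite (bigD1 x) //= lerDl sumr_ge0.
Qed.

Variable L : R.
Hypothesis L_ge : forall x, 1 <= L * q (~: [set x]) x.

Let exit_gt0 B : B != finset.setT -> 0 < \sum_y q B y.
Proof.
move=> /q_gt0[y y0]; rewrite (bigD1 y) //= ltr_wpDr //.
by apply: sumr_ge0.
Qed.

Let hstep f B : R :=
  if B == finset.setT then 0 else
  (1 + \sum_y q B y * (if y \in B then 0 else f (y |: B))) / \sum_y q B y.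

(* The complement shrinks at each step of the recursion, so #|~: B| steps suffice. *)
Definition mean_filling B : R := iter #|~: B| hstep (fun=> 0) B.
Local Notation h := mean_filling.

Lemma mean_filling_setT : h finset.setT = 0.
Proof. by rewrite /h finset.setCT cards0. Qed.

Lemma mean_filling_eq B : B != finset.setT ->
  \sum_y q B y * (h B - h (y |: B)) = 1.
Proof.
move=> BT; have [w wB] : exists w, w \notin B.
  by move: BT; rewrite -finset.subTset => /fintype.subsetPn[w _ wB]; exists w.
have e : h B * \sum_y q B y = 1 + \sum_y q B y * h (y |: B).
  rewrite /h (card_setC_setU1 wB) /= {1}/hstep (negPf BT).
  rewrite mulfVK ?gt_eqF ?exit_gt0 //; congr (_ + _); apply: eq_bigr => y _.
  case: ifPn => yB; first by rewrite q_in ?mul0r.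
  suff -> : #|~: (y |: B)| = #|~: (w |: B)| by [].
  by apply: succn_inj; rewrite -!card_setC_setU1.
under eq_bigr do rewrite mulrBr.
by rewrite sumrB -mulr_suml mulrC e addrK.
Qed.

Lemma mean_filling_lipschitz B w : 0 <= h B - h (w |: B) <= L.
Proof.
have L0 : 0 <= L.
  have /card_gt0P[x _] := V_gt0.
  have := L_ge x; rewrite leNgt; apply: contraNle => L0.
  by rewrite (le_lt_trans _ ltr01) // mulr_le0_ge0 // ltW.
have [n] := ubnP #|~: B|; elim: n B w => // n IH B w; rewrite ltnS => cn.
have [wB|wB] := boolP (w \in B); first by rewrite setU1_in // subrr lexx.
have BT : B != finset.setT by apply: contraNneq wB => ->; rewrite inE.
have cB (v : V) : v \notin B -> (#|~: (v |: B)| < n)%N.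
  by move=> vB; move: cn; rewrite (card_setC_setU1 vB).
have [CT|CT] := eqVneq (w |: B) finset.setT.
  have eB : B = ~: [set w].
    apply/setP => z; have := congr1 (fun S : {set V} => z \in S) CT; rewrite !inE.
    by have [->|//] := eqVneq z w; rewrite (negPf wB).
  have := mean_filling_eq BT; rewrite (bigD1 w) //= big1 ?addr0 => [|y yw]; last first.
    by rewrite q_in ?mul0r // eB !inE.
  move=> e; have qw0 : 0 < q B w.
    by rewrite lt_def q_ge0 andbT; apply: contra_eq_neq e => ->; rewrite mul0r eq_sym oner_eq0.
  have -> : h B - h (w |: B) = (q B w)^-1 by rewrite -[RHS]mulr1 -e mulKf ?gt_eqF.
  rewrite invr_ge0 q_ge0 /= -[leLHS]mul1r ler_pdivrMr // eB.
  exact: L_ge.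
have hE C : C != finset.setT -> fill h C = h C - 1.
  move=> /mean_filling_eq e; rewrite /fill -[in RHS]e; congr (_ + _).
  by rewrite -sumrN; apply: eq_bigr => y _; ring.
have := fill_increment h wB; rewrite !hE //.
set S1 := \sum_y r B w y * _; set S2 := \sum_(y | y != w) _ => e.
have e' : (\sum_y q B y) * (h B - h (w |: B)) = q B w * S1 + S2 by lra.
have I y : 0 <= h (w |: B) - h (y |: (w |: B)) <= L by apply: IH; exact: cB.
have S1b : 0 <= S1 <= L.
  apply/andP; split.
    by apply: sumr_ge0 => y _; rewrite mulr_ge0 //; case/andP: (I y).
  apply: le_trans (_ : \sum_y r B w y * L <= _).
    by apply: ler_sum => y _; rewrite ler_wpM2l //; case/andP: (I y).
  by rewrite -mulr_suml ler_piMl.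
have S2b : 0 <= S2 <= (\sum_(y | y != w) q B y) * L.
  have J y : y \notin B -> 0 <= h (y |: B) - h (w |: (y |: B)) <= L.
    by move=> yB; apply: IH; exact: cB.
  apply/andP; split.
    apply: sumr_ge0 => y _; have [yB|yB] := boolP (y \in B); first by rewrite q_in ?mul0r.
    by rewrite mulr_ge0 //; case/andP: (J y yB).
  rewrite mulr_suml; apply: ler_sum => y _.
  have [yB|yB] := boolP (y \in B); first by rewrite q_in ?mul0r.
  by rewrite ler_wpM2l //; case/andP: (J y yB).
have q0 := exit_gt0 BT.
case/andP: S1b => S10 S1L; case/andP: S2b => S20 S2L.
apply/andP; split.
  by rewrite -(pmulr_rge0 _ q0) e' addr_ge0 // mulr_ge0.
rewrite -(ler_pM2l q0) e' [in leRHS](bigD1 w) //= mulrDl.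
by apply: lerD => //; rewrite ler_wpM2l.
Qed.

Lemma mean_filling_antitone : antitone h.
Proof. by move=> B w; case/andP: (mean_filling_lipschitz B w); rewrite subr_ge0. Qed.

Lemma mean_filling_ge0 B : 0 <= h B.
Proof.
rewrite -mean_filling_setT; apply: antitone_subset; last exact: finset.subsetT.
exact: mean_filling_antitone.
Qed.

Lemma mean_filling_ge1 B : B != finset.setT -> 1 <= h B.
Proof.
move=> BT; rewrite -(mean_filling_eq BT).
apply: le_trans (_ : \sum_y q B y * h B <= _).
  by apply: ler_sum => y _; rewrite ler_wpM2l // gerBl mean_filling_ge0.
by rewrite -mulr_suml ler_piMl // mean_filling_ge0.
Qed.

Lemma mean_filling_bound_ge1 : 1 <= L.
Proof.
have /card_gt0P[x _] := V_gt0; have L1 := L_ge x.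
have q1 : q (~: [set x]) x <= 1.
  apply: le_trans (q_sum_le1 (~: [set x])).
  by rewrite (bigD1 x) //= lerDl sumr_ge0.
have q0 := q_ge0 (~: [set x]) x.
rewrite leNgt; apply/negP => Llt; have L10 : 0 <= 1 - L by lra.
have qe : q (~: [set x]) x = 1 by have := mulr_ge0 L10 q0; lra.
by move: L1; rewrite qe; lra.
Qed.

(* A supersolution dominating E (T - s)^2, where T is the filling time from B. *)
Definition filling_moment B (s : R) : R := (L - 1) * h B + (h B - s) ^+ 2.
Local Notation F := filling_moment.

Lemma filling_moment_ge B s : (h B - s) ^+ 2 <= F B s.
Proof. by rewrite /F lerDr mulr_ge0 ?mean_filling_ge0 // subr_ge0 mean_filling_bound_ge1. Qed.

Lemma fill_filling_moment B s : B != finset.setT ->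
  fill (fun C => F C (s - 1)) B <= F B s.
Proof.
move=> BT; have e := mean_filling_eq BT.
apply: le_trans (_ : F B (s - 1) +
    \sum_y q B y * (h B - h (y |: B)) * (1 - 2 * (h B - s + 1)) <= _).
  rewrite /fill lerD2l; apply: ler_sum => y _; rewrite -mulrA ler_wpM2l //.
  have /andP[d0 dL] := mean_filling_lipschitz B y.
  rewrite /F; set d := h B - h (y |: B) in d0 dL *.
  have -> : h (y |: B) = h B - d by rewrite /d; ring.
  have : d * d <= d * L by rewrite ler_wpM2l.
  nra.
by rewrite -mulr_suml e mul1r /F; lra.
Qed.

Lemma unfilled_upper t B s : s <= t.+1%:R ->
  unfilled t B * (t.+1%:R - s) ^+ 2 <= F B s.
Proof.
elim: t B s => [|t IH] B s st; have [->|BT] := eqVneq B finset.setT.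
- rewrite unfilled_setT mul0r; apply: le_trans (filling_moment_ge _ _); exact: sqr_ge0.
- rewrite /unfilled /= BT mul1r; apply: le_trans (filling_moment_ge _ _).
  have := mean_filling_ge1 BT; nra.
- rewrite unfilled_setT mul0r; apply: le_trans (filling_moment_ge _ _); exact: sqr_ge0.
- apply: le_trans (fill_filling_moment s BT).
  set c := (t.+2%:R - s) ^+ 2.
  have -> : unfilled t.+1 B * c = fill (fun C => 0 + c * unfilled t C) B.
    by rewrite fill_linear unfilledS add0r mulrC.
  have I C : 0 + c * unfilled t C <= F C (s - 1).
    rewrite add0r mulrC (_ : c = (t.+1%:R - (s - 1)) ^+ 2).
      by apply: IH; move: st; rewrite -natr1; lra.
    by rewrite /c -[t.+2%:R]natr1; congr (_ ^+ 2); ring.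
  by apply: fill_mono => [y|]; exact: I.
Qed.

Lemma unfilled_lower t B s : t%:R <= s ->
  (1 - unfilled t B) * (s - t%:R) ^+ 2 <= F B s.
Proof.
elim: t B s => [|t IH] B s st; have [->|BT] := eqVneq B finset.setT.
- rewrite unfilled_setT subr0 mul1r subr0 /F mean_filling_setT.
  by rewrite mulr0 add0r sub0r sqrrN.
- rewrite /unfilled /= BT subrr mul0r; apply: le_trans (filling_moment_ge _ _).
  exact: sqr_ge0.
- rewrite unfilled_setT subr0 mul1r /F mean_filling_setT mulr0 add0r sub0r sqrrN.
  by rewrite ler_sqr ?nnegrE ?subr_ge0 ?gerBl // (le_trans _ st).
- apply: le_trans (fill_filling_moment s BT).
  set c := (s - t.+1%:R) ^+ 2.
  have -> : (1 - unfilled t.+1 B) * c = fill (fun C => c + - c * unfilled t C) B.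
    by rewrite fill_linear unfilledS; ring.
  have I C : c + - c * unfilled t C <= F C (s - 1).
    rewrite (_ : c + _ = (1 - unfilled t C) * (s - 1 - t%:R) ^+ 2).
      by apply: IH; move: st; rewrite -natr1; lra.
    by rewrite /c -[t.+1%:R]natr1; ring.
  by apply: fill_mono => [y|]; exact: I.
Qed.

End Filling.

(** * The strong stationary time *)

Section StrongStationary.
Variables (R : realType) (A : arw_params R).
Local Notation V := (site A).
Local Notation K := (@walk R A).
Local Notation lam := (sleep_rate A).
Local Notation P := (@arw_matrix R A).
Local Notation fillA := (fill (@source_exit R A)).
Local Notation S := (@stabilisation R A).
Implicit Types (eta : config A) (x y z w : V) (xi zeta : stable_config A)
  (B C D : {set V}).

Lemma stabilisation_jump eta x xi : (0 < active eta x)%N ->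
  S (add_active eta x) xi =
  \sum_y K x y * S (add_active eta y) xi + (1 - \sum_y K x y) * S eta xi.
Proof.
move=> ax; have l0 := sleep_rate_gt0 A.
have remK : remove_active (add_active eta x) x = eta.
  rewrite remove_activeE add_activeE; apply/ffunP => w; rewrite !ffunE.
  by case: eqP => // ->; move: ax; rewrite /active; case: (eta x).
have dozeK : update doze1 x (add_active eta x) = add_active eta x.
  rewrite add_activeE; apply/ffunP => w; rewrite !ffunE.
  by case: eqP => // ->; move: ax; rewrite /active; case: (eta x) => [[|k]|].
have := topple_stabilisation x (add_active eta x) xi.
rewrite /topple gtn_eqF ?active_add_active_same // !big_option /= dozeK remK.
under [\sum_y K x y / _ * _]eq_bigr do rewrite mulrAC.
rewrite -mulr_suml; set s := \sum_y K x y * _; set k := \sum_y K x y.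
set u := S (add_active eta x) xi => e.
have n0 : 1 + lam != 0 by rewrite gt_eqF // addr_gt0.
have e2 : (1 + lam) * u = lam * u + ((1 - k) * S eta xi + s).
  by rewrite -{1}e; field.
by move: e2; rewrite mulrDl mul1r; lra.
Qed.

(* One active particle added at each site of B. *)
Definition pile eta B : config A := [ffun x => if x \in B then add1 (eta x) else eta x].

Lemma pile0 eta : pile eta finset.set0 = eta.
Proof. by apply/ffunP => x; rewrite ffunE inE. Qed.

Lemma add_active_pile eta B x : x \notin B ->
  add_active (pile eta B) x = pile eta (x |: B).
Proof.
move=> xB; rewrite add_activeE; apply/ffunP => z; rewrite !ffunE !inE.
by case: eqP => //= ->; rewrite (negPf xB).
Qed.

Lemma active_pile eta B x : x \in B -> (0 < active (pile eta B) x)%N.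
Proof. by move=> xB; rewrite /active ffunE xB; case: (eta x). Qed.

Lemma stabilisation_pile_add eta B x xi : S (add_active (pile eta B) x) xi =
  S (pile eta B) xi +
  \sum_y exit B y x * (S (pile eta (y |: B)) xi - S (pile eta B) xi).
Proof.
set c := S (pile eta B) xi; move: x.
apply: (@dirichlet_uniq _ _ B _ _ (fun x => (1 - \sum_y K x y) * c)) => x xB.
- by rewrite stabilisation_jump ?active_pile.
- under eq_bigr do rewrite exit_in // mulr_suml.
  rewrite exchange_big /=.
  under [in RHS]eq_bigr do rewrite mulrDr.
  rewrite big_split /= -mulr_suml.
  under [X in _ = _ + X + _]eq_bigr do rewrite mulr_sumr.
  under [X in _ + X = _]eq_bigr do under eq_bigr do rewrite -mulrA.
  ring.
- rewrite add_active_pile // (bigD1 x) //= exit_out // eqxx mul1r.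
  rewrite big1 ?addr0 => [|y /negPf yx]; first by rewrite addrC subrK.
  by rewrite exit_out // eq_sym yx mul0r.
Qed.

Lemma source_stabilisation_pile eta B xi :
  \sum_x source x * S (add_active (pile eta B) x) xi =
  fillA (fun C => S (pile eta C) xi) B.
Proof.
under eq_bigr do rewrite stabilisation_pile_add mulrDr mulr_sumr.
rewrite big_split /= -mulr_suml source_sum1 mul1r exchange_big; congr (_ + _).
apply: eq_bigr => y _ /=; rewrite /source_exit mulr_suml.
by apply: eq_bigr => x _; rewrite mulrA.
Qed.

Lemma fill_sum (I : finType) (F : I -> {set V} -> R) (a : I -> R) B :
  fillA (fun C => \sum_i F i C * a i) B = \sum_i fillA (F i) B * a i.
Proof.
rewrite /fill; under [RHS]eq_bigr do rewrite mulrDl mulr_suml.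
rewrite big_split exchange_big /=; congr (_ + _); apply: eq_bigr => y _.
rewrite -sumrB mulr_sumr; apply: eq_bigr => i _; ring.
Qed.

(* The law of the chain after t steps, when the initial state is drawn from the
   stabilisation of [pile eta B]. *)
Definition pile_law t eta xi B : R := \sum_xi' S (pile eta B) xi' * mpow P t xi' xi.

Lemma pile_lawS t eta xi B : pile_law t.+1 eta xi B = fillA (pile_law t eta xi) B.
Proof.
rewrite /pile_law fill_sum /=.
under eq_bigr do rewrite mulr_sumr.
rewrite exchange_big /=; apply: eq_bigr => z _.
under eq_bigr do rewrite mulrA.
rewrite -mulr_suml; congr (_ * _); rewrite -source_stabilisation_pile.
under [RHS]eq_bigr do rewrite stabilisation_add mulr_sumr.
rewrite exchange_big /=; apply: eq_bigr => xi' _; rewrite /arw_matrix mulr_sumr.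
by apply: eq_bigr => x _; rewrite mulrCA.
Qed.

Lemma pile_law0 eta xi B : pile_law 0 eta xi B = S (pile eta B) xi.
Proof.
have e xi' : mpow P 0 xi' xi = (xi' == xi)%:R by [].
rewrite /pile_law; under eq_bigr do rewrite e.
rewrite (bigD1 xi) //= eqxx [X in X + _]mulr1.
by rewrite big1 ?addr0 // => xi' /negPf ->; rewrite [LHS]mulr0.
Qed.

Lemma pile_law_set0 t zeta xi :
  pile_law t (of_stable zeta) xi finset.set0 = mpow P t zeta xi.
Proof.
rewrite /pile_law pile0 (bigD1 zeta) //= stabilisation_of_stable eqxx mul1r.
rewrite big1 ?addr0 // => xi' /negPf ne.
by rewrite stabilisation_of_stable eq_sym ne mul0r.
Qed.

Definition empty : config A := [ffun=> Some 0%N].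

Definition stationary xi : R := S (pile empty finset.setT) xi.

Lemma stabilisation_all_active eta x xi : (forall z, (0 < active eta z)%N) ->
  S (add_active eta x) xi = S eta xi.
Proof.
move=> a; move: x; apply: (@dirichlet_uniq _ _ finset.setT _ _
  (fun x => (1 - \sum_y K x y) * S eta xi)) => x; rewrite ?inE // => _.
  exact: stabilisation_jump.
by rewrite -mulr_suml; ring.
Qed.

Lemma stabilisation_all_active_pile eta D xi : (forall z, (0 < active eta z)%N) ->
  S (pile eta D) xi = S eta xi.
Proof.
move=> a; have [n] := ubnP #|D|; elim: n D => // n IH D; rewrite ltnS => cD.
have [->|[x xD]] := set_0Vmem D; first by rewrite pile0.
rewrite -(finset.setD1K xD) -add_active_pile; last by rewrite !inE eqxx.
rewrite stabilisation_all_active => [|z]; last first.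
  by rewrite /active ffunE; have := a z; rewrite /active; case: ifP; case: (eta z).
by apply: IH; move: cD; rewrite (cardsD1 x) xD add1n.
Qed.

Lemma stabilisation_pile_setT zeta xi :
  S (pile (of_stable zeta) finset.setT) xi = stationary xi.
Proof.
have -> : pile (of_stable zeta) finset.setT =
    pile (pile empty finset.setT) [set x | zeta x]%SET.
  by apply/ffunP => x; rewrite !ffunE !inE; case: (zeta x).
by apply: stabilisation_all_active_pile => z; apply: active_pile; rewrite inE.
Qed.

Lemma pile_law_ge t zeta xi B : (1 - unfilled (@source_exit R A) t B) * stationary xi <=
  pile_law t (of_stable zeta) xi B.
Proof.
elim: t B => [|t IH] B.
  rewrite pile_law0 /unfilled /=; have [->|_] := eqVneq B finset.setT.
    by rewrite subr0 mul1r stabilisation_pile_setT.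
  by rewrite subrr mul0r stabilisation_ge0.
rewrite pile_lawS unfilledS.
have -> : (1 - fillA (unfilled (@source_exit R A) t) B) * stationary xi =
    fillA (fun C => stationary xi + - stationary xi * unfilled (@source_exit R A) t C) B.
  by rewrite fill_linear; ring.
have I C : stationary xi + - stationary xi * unfilled (@source_exit R A) t C <=
    pile_law t (of_stable zeta) xi C.
  by apply: le_trans (IH C); rewrite le_eqVlt; apply/orP; left; apply/eqP; ring.
apply: fill_mono => [||y|]; [exact: source_exit_ge0|exact: source_exit_sum_le1|exact: I|exact: I].
Qed.

Definition stable_full : stable_config A := [ffun=> true].
Definition stable_empty : stable_config A := [ffun=> false].

Lemma of_stable_empty : of_stable stable_empty = empty.
Proof. by apply/ffunP => x; rewrite !ffunE. Qed.

Lemma pile_law_full t B : pile_law t empty stable_full B =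
  (1 - unfilled (@source_exit R A) t B) * stationary stable_full.
Proof.
elim: t B => [|t IH] B.
  rewrite pile_law0 /unfilled /=; have [->|BT] := eqVneq B finset.setT.
    by rewrite subr0 mul1r.
  rewrite subrr mul0r; apply: stabilisation_total.
  rewrite /total (eq_bigr (fun x => (x \in B) : nat)) => [|x _]; last first.
    by rewrite !ffunE; case: (x \in B).
  rewrite [ltnRHS](eq_bigr (fun=> 1%N)) => [|x _]; last by rewrite !ffunE.
  rewrite sum1_card -big_mkcond /= sum1_card; move: BT.
  by rewrite -properT => /proper_card; rewrite cardsT.
rewrite pile_lawS unfilledS (_ : pile_law t empty stable_full = fun C =>
    stationary stable_full + - stationary stable_full * unfilled (@source_exit R A) t C).
  by rewrite fill_linear; ring.
by apply/funext => C; rewrite IH; ring.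
Qed.

Lemma stationary_gt0 xi : 0 < stationary xi.
Proof.
rewrite lt_def stabilisation_ge0 andbT; apply/negP => /eqP p0.
pose Z eta := S eta xi = 0.
have Zf x i eta : Z eta -> (0 < active eta x)%N -> 0 < weight x i -> Z (follow x i eta).
  rewrite /Z -(topple_stabilisation x) /topple => e ax wi; move: e.
  rewrite gtn_eqF // => /eqP; rewrite psumr_eq0 => [|j _]; last first.
    by rewrite mulr_ge0 ?weight_ge0 ?stabilisation_ge0.
  move/allP/(_ i (mem_index_enum i)); rewrite /= mulf_eq0 gt_eqF //=.
  by move/eqP.
pose supp := [set x | xi x]%SET.
have Zsupp : Z (pile empty supp).
  have : forall n B, #|B| = n -> supp \subset B -> Z (pile empty B) -> Z (pile empty supp).
    elim=> [|n IH] B cB sB ZB.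
      move/eqP: cB; rewrite cards_eq0 => /eqP cB; move: sB ZB; rewrite cB.
      by rewrite finset.subset0 => /eqP ->.
    have [e|[x]] := set_0Vmem (B :\: supp).
      suff -> : supp = B by [].
      by apply/eqP; rewrite finset.eqEsubset sB -finset.setD_eq0 e eqxx.
    rewrite inE => /andP[xs xB]; apply: (IH (B :\ x)).
    - by move: cB; rewrite (cardsD1 x) xB add1n => -[].
    - apply/fintype.subsetP => z zs; rewrite !inE (fintype.subsetP sB _ zs) andbT.
      by apply: contraNneq xs => <-.
    apply: (closed_kill Zf (x := x)) => [z|].
      by rewrite !ffunE; case: ifP.
    by rewrite add_active_pile ?finset.setD1K // !inE eqxx.
  move=> /(_ _ finset.setT erefl); apply; first exact: finset.subsetT.
  exact: p0.
pose mix D : config A := [ffun x => if x \in D then None else Some (xi x : nat)].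
have Zmix : forall n D, #|D| = n -> D \subset supp -> Z (mix D).
  elim=> [|n IH] D cD sD.
    rewrite (_ : mix D = pile empty supp) //; apply/ffunP => x.
    move/eqP: cD; rewrite cards_eq0 => /eqP ->; rewrite !ffunE !inE.
    by case: (xi x).
  have /card_gt0P[x xD] : (0 < #|D|)%N by rewrite cD.
  have xix : xi x by have := fintype.subsetP sD _ xD; rewrite inE.
  have -> : mix D = follow x None (mix (D :\ x)).
    apply/ffunP => z; rewrite !ffunE !inE.
    by have [->|_] := eqVneq z x; rewrite //= xD xix.
  apply: Zf.
  - apply: IH; first by move: cD; rewrite (cardsD1 x) xD add1n => -[].
    by apply: fintype.subset_trans sD; exact: subD1set.
  - by rewrite /active !ffunE !inE eqxx /= xix.
  - by rewrite /= divr_gt0 ?addr_gt0 ?sleep_rate_gt0.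
have := Zmix _ supp erefl (fintype.subxx _).
rewrite /Z (_ : mix supp = of_stable xi).
  by rewrite stabilisation_of_stable eqxx => /eqP; rewrite oner_eq0.
by apply/ffunP => x; rewrite !ffunE inE; case: (xi x).
Qed.

End StrongStationary.

(** * Distances to equilibrium *)

Section FiniteChain.
Variables (R : realType) (X : finType) (P : X -> X -> R) (m : X -> R).
Hypothesis P_sum1 : forall x, \sum_y P x y = 1.
Hypothesis hm : invariant_distribution P m.
Implicit Types (x y z : X) (B : {set X}).

Lemma mpow_sum1 t x : \sum_y mpow P t x y = 1.
Proof.
elim: t x => [|t IH] x /=.
  rewrite (bigD1 x) //= eqxx big1 ?addr0 // => y /negPf.
  by rewrite eq_sym => ->.
rewrite exchange_big /= -[RHS](P_sum1 x); apply: eq_bigr => z _.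
by rewrite -mulr_sumr IH mulr1.
Qed.

Lemma mpowD s t x y : mpow P (s + t) x y = \sum_z mpow P s x z * mpow P t z y.
Proof.
elim: s x => [|s IH] x /=.
  rewrite add0n (bigD1 x) //= eqxx mul1r big1 ?addr0 // => z /negPf.
  by rewrite eq_sym => ->; rewrite mul0r.
under eq_bigr do rewrite IH mulr_sumr.
rewrite exchange_big /=; apply: eq_bigr => z _; rewrite mulr_suml.
by apply: eq_bigr => w _; rewrite mulrA.
Qed.

Lemma invariant_mpow t y : \sum_x m x * mpow P t x y = m y.
Proof.
case: hm => _ _ mP; elim: t y => [|t IH] y /=.
  by rewrite (bigD1 y) //= eqxx mulr1 big1 ?addr0 // => x /negPf ->; rewrite mulr0.
rewrite -[RHS]IH; under eq_bigr do rewrite mulr_sumr.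
rewrite exchange_big /=; apply: eq_bigr => z _; rewrite -mP mulr_suml.
by apply: eq_bigr => x _; rewrite mulrA.
Qed.

Lemma d_tv_ge0 t : 0 <= d_tv P m t.
Proof. by rewrite /d_tv; elim/big_rec: _ => // i u _ u0; rewrite le_max u0 orbT. Qed.

Lemma le_d_tv t x B :
  `|\sum_(y in B) mpow P t x y - \sum_(y in B) m y| <= d_tv P m t.
Proof.
exact: (le_bigmax 0 (fun p : X * {set X} =>
  `|\sum_(y in p.2) mpow P t p.1 y - \sum_(y in p.2) m y|) (x, B)).
Qed.

Lemma d_tv_le t (s : R) : 0 <= s ->
  (forall x y, (1 - s) * m y <= mpow P t x y) -> d_tv P m t <= s.
Proof.
case: hm => m0 m1 _ s0 h; apply: bigmax_le => // -[x B] _ /=.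
have half (C : {set X}) : \sum_(y in C) m y - \sum_(y in C) mpow P t x y <= s.
  have mC : \sum_(y in C) m y <= 1.
    by rewrite -m1 [leRHS](bigID (mem C)) /= lerDl sumr_ge0.
  have : (1 - s) * \sum_(y in C) m y <= \sum_(y in C) mpow P t x y.
    by rewrite mulr_sumr; apply: ler_sum => y _.
  have := ler_piMr s0 mC; lra.
rewrite ler_norml; apply/andP; split; first by have := half B; lra.
have := half (~: B); have := mpow_sum1 t x; have := m1.
rewrite (bigID (mem B)) /= => e1; rewrite (bigID (mem B)) /= => e2.
under eq_bigl do rewrite inE.
under [X in _ - X]eq_bigl do rewrite inE.
lra.
Qed.

(* The increments of f enter only through its oscillation, since both rows have
   mass 1. *)
Lemma oscillation_contraction t (f : X -> R) (c : R) :
  (forall x y, `|f x - f y| <= c) -> forall x y,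
  `|\sum_z mpow P t x z * f z - \sum_z mpow P t y z * f z| <= 2 * d_tv P m t * c.
Proof.
move=> fc x0 y0.
have c0 : 0 <= c by apply: le_trans (normr_ge0 _) (fc x0 x0).
suff H x y : \sum_z mpow P t x z * f z - \sum_z mpow P t y z * f z <=
    2 * d_tv P m t * c.
  by rewrite ler_norml; apply/andP; split; [have := H y0 x0; lra | exact: H].
case: (@arg_minP _ _ _ x0 xpredT f isT) => zm _ minf.
pose B := [set z | mpow P t y z < mpow P t x z]%SET.
have -> : \sum_z mpow P t x z * f z - \sum_z mpow P t y z * f z =
    \sum_z (mpow P t x z - mpow P t y z) * (f z - f zm).
  under [RHS]eq_bigr do rewrite mulrBl !mulrBr.
  rewrite !sumrB -!mulr_suml !mpow_sum1; ring.
apply: le_trans (_ : \sum_(z in B) (mpow P t x z - mpow P t y z) * c <= _).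
  rewrite [leRHS]big_mkcond; apply: ler_sum => z _; rewrite inE.
  have fz : 0 <= f z - f zm <= c.
    by rewrite subr_ge0 minf //= (le_trans (ler_norm _)) // fc.
  case: ltP => h; first by rewrite ler_wpM2l ?subr_ge0 ?(ltW h) //; case/andP: fz.
  by rewrite mulr_le0_ge0 // ?subr_le0 //; case/andP: fz.
rewrite -mulr_suml ler_wpM2r // sumrB.
have := le_d_tv t x B; have := le_d_tv t y B; rewrite !ler_norml => /andP[h _] /andP[_ h'].
lra.
Qed.

Lemma mpow_oscillation t k xi x y :
  `|mpow P (k * t) x xi - mpow P (k * t) y xi| <= (2 * d_tv P m t) ^+ k.
Proof.
elim: k x y => [|k IH] x y.
  rewrite mul0n expr0 /=; case: (x == xi); case: (y == xi);
    by rewrite ?subrr ?normr0 ?ler01 // ?subr0 ?sub0r ?normrN normr1.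
rewrite mulSn !mpowD exprS; exact: oscillation_contraction.
Qed.

Lemma mpow_invariant_dist t k xi x :
  `|mpow P (k * t) x xi - m xi| <= (2 * d_tv P m t) ^+ k.
Proof.
case: (hm) => m0 m1 _.
have -> : mpow P (k * t) x xi - m xi =
    \sum_y m y * (mpow P (k * t) x xi - mpow P (k * t) y xi).
  under eq_bigr do rewrite mulrBr.
  by rewrite sumrB -mulr_suml m1 mul1r invariant_mpow.
apply: le_trans (ler_norm_sum _ _ _) _.
apply: le_trans (_ : \sum_y m y * (2 * d_tv P m t) ^+ k <= _).
  by apply: ler_sum => y _; rewrite normrM ger0_norm // ler_wpM2l // mpow_oscillation.
by rewrite -mulr_suml m1 mul1r.
Qed.

End FiniteChain.

Lemma half_timeP (R : realType) (d : nat -> R) t : d t <= 2^-1 ->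
  [/\ d (half_time d) <= 2^-1, (half_time d <= t)%N
    & forall s, (s < half_time d)%N -> 2^-1 < d s].
Proof.
move=> dt; rewrite /half_time; case: pselect => [ex|[]]; last by exists t.
case: ex_minnP => n dn min_n; split=> // [|s]; first exact: min_n.
by rewrite ltNge; apply: contraTN => /min_n; rewrite leqNgt.
Qed.

(* What Chebyshev's inequality gives for the tail s t = P(T > t) of an integer
   variable T of mean mu and variance at most (L - 1) mu. *)
Definition chebyshev_tail (R : realType) (s : nat -> R) (mu L : R) : Prop :=
  [/\ 1 <= L, L <= mu,
    forall t, mu <= t.+1%:R -> s t * (t.+1%:R - mu) ^+ 2 <= (L - 1) * mu
  & forall t, t%:R <= mu -> (1 - s t) * (mu - t%:R) ^+ 2 <= (L - 1) * mu].

Section Chain.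
Variables (R : realType) (A : arw_params R) (m : stable_config A -> R).
Local Notation P := (@arw_matrix R A).
Local Notation q := (@source_exit R A).
Local Notation sigma t := (unfilled q t finset.set0).
Hypothesis hm : invariant_distribution P m.

Lemma arw_matrix_sum1 xi : \sum_xi' P xi xi' = 1.
Proof.
rewrite exchange_big /= -[RHS](source_sum1 A); apply: eq_bigr => x _.
by rewrite -mulr_sumr stabilisation_sum1 mulr1.
Qed.

Let q_ge0 : forall B y, 0 <= q B y := @source_exit_ge0 R A.
Let q_sum : forall B, \sum_y q B y <= 1 := @source_exit_sum_le1 R A.
Let q_in : forall (B : {set site A}) y, y \in B -> q B y = 0 := @source_exit_in R A.
Let q_markov : forall (B : {set site A}) w y, w \notin B -> y != w ->
  q (w |: B) y = q B y + q B w * exit (w |: B) y w := @source_exit_markov R A.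
Let q_gt0 : forall B, B != finset.setT -> exists y, 0 < q B y := @source_exit_gt0 R A.
Let r_ge0 : forall (B : {set site A}) (w y : site A), 0 <= exit (w |: B) y w :=
  fun B w y => exit_ge0 (w |: B) y w.
Let r_sum : forall (B : {set site A}) (w : site A), \sum_y exit (w |: B) y w <= 1 :=
  fun B w => exit_sum_le1 (w |: B) w.

Lemma unfilled_tail : exists mu L : R,
  chebyshev_tail (fun t => sigma t) mu L /\ forall t, (1 - L^-1) ^+ t <= sigma t.
Proof.
have /card_gt0P[v _] := site_nonempty A.
case: (@arg_minP _ _ _ v xpredT (fun x => q (~: [set x]) x) isT) => x0 _ minq.
have T0 x : ~: [set x] != finset.setT :> {set site A}.
  by apply/eqP => /setP/(_ x); rewrite !inE eqxx.
have q0 x : 0 < q (~: [set x]) x.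
  have [y] := q_gt0 (T0 x); have [->//|yx] := eqVneq y x.
  by rewrite q_in ?ltxx // !inE.
pose L := (q (~: [set x0]) x0)^-1.
have L_ge x : 1 <= L * q (~: [set x]) x.
  by rewrite mulrC ler_pdivlMr // mul1r minq.
have am := mean_filling_antitone (site_nonempty A) q_ge0 q_in r_ge0 r_sum q_markov q_gt0 L_ge.
have F0 : filling_moment q L finset.set0 (mean_filling q finset.set0) =
    (L - 1) * mean_filling q finset.set0.
  by rewrite /filling_moment subrr expr0n addr0.
exists (mean_filling q finset.set0), L; split; [split|].
- exact: (mean_filling_bound_ge1 (site_nonempty A) q_ge0 q_sum L_ge).
- apply: le_trans (antitone_subset am (finset.sub0set (~: [set x0]))).
  have := mean_filling_eq q_ge0 q_in q_gt0 (T0 x0).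
  rewrite (bigD1 x0) //= finset.setUCr mean_filling_setT subr0 big1 ?addr0 => [e|y yx].
    by rewrite -[leLHS]mulr1 -e mulKf ?gt_eqF.
  by rewrite q_in ?mul0r // !inE.
- move=> t ht; rewrite -F0.
  exact: (unfilled_upper (site_nonempty A) q_ge0 q_sum q_in r_ge0 r_sum q_markov q_gt0 L_ge).
- move=> t ht; rewrite -F0.
  exact: (unfilled_lower (site_nonempty A) q_ge0 q_sum q_in r_ge0 r_sum q_markov q_gt0 L_ge).
- move=> t; rewrite invrK.
  apply: le_trans (unfilled_one_hole q_ge0 q_sum q_in t x0) _.
  apply: antitone_subset (finset.sub0set _).
  exact: (unfilled_antitone q_ge0 q_sum r_ge0 q_markov).
Qed.

Lemma mpow_ge_stationary t xi xi' :
  (1 - sigma t) * stationary xi' <= mpow P t xi xi'.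
Proof. by rewrite -pile_law_set0; exact: pile_law_ge. Qed.

Lemma mpow_full t : mpow P t (stable_empty A) (stable_full A) =
  (1 - sigma t) * stationary (stable_full A).
Proof. by rewrite -pile_law_set0 of_stable_empty pile_law_full. Qed.

Let sigma01 t : 0 <= sigma t <= 1.
Proof. exact: (unfilled_bounds q_ge0 q_sum). Qed.

Lemma invariant_stationary xi : m xi = stationary xi.
Proof.
have [m0 m1 _] := hm.
have le_m xi' : stationary xi' <= m xi'.
  have [mu [L [[L1 Lmu up _] _]]] := unfilled_tail.
  have h t : (1 - sigma t) * stationary xi' <= m xi'.
    rewrite -(invariant_mpow hm t) -[leLHS]mul1r -{1}m1 mulr_suml.
    by apply: ler_sum => x _; rewrite ler_wpM2l // mpow_ge_stationary.
  have p0 := stationary_gt0 xi'.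
  rewrite leNgt; apply/negP => lt.
  pose e := (stationary xi' - m xi') / stationary xi'.
  have e0 : 0 < e by rewrite divr_gt0 // subr_gt0.
  have es t : e <= sigma t.
    by rewrite ler_pdivrMr //; have := h t; lra.
  pose c := (L - 1) * mu / e.
  have c0 : 0 <= c.
    by apply: divr_ge0; [apply: mulr_ge0; lra | exact: ltW].
  pose t := Num.truncn (mu + c + 1).
  have ht : mu + c + 1 < t.+1%:R := truncnS_gt _.
  have := up t; have := es t.
  set s := sigma t; set T := t.+1%:R in ht *.
  move=> h1 /(_ _) h2.
  have : s * (T - mu) ^+ 2 <= (L - 1) * mu by apply: h2; lra.
  have -> : (L - 1) * mu = c * e by rewrite /c divfK // gt_eqF.
  have : e * (T - mu) ^+ 2 <= s * (T - mu) ^+ 2 by rewrite ler_wpM2r // sqr_ge0.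
  have : c < (T - mu) ^+ 2 by nra.
  move=> k1 k2 k3; have : e * (T - mu) ^+ 2 <= c * e by exact: le_trans k2 k3.
  by rewrite mulrC ler_pM2r // leNgt k1.
apply/eqP; rewrite -subr_eq0; apply/eqP.
have : \sum_xi' (m xi' - stationary xi') = 0.
  by rewrite sumrB m1 stabilisation_sum1 subrr.
move/eqP; rewrite psumr_eq0 => [|xi' _]; last by rewrite subr_ge0.
by move/allP/(_ xi (mem_index_enum xi))/eqP.
Qed.

Lemma d_sep_unfilled t : d_sep P m t = sigma t.
Proof.
apply/eqP; rewrite eq_le; apply/andP; split.
  apply: bigmax_le => [|[xi xi'] _ /=]; first by case/andP: (sigma01 t).
  have p0 := stationary_gt0 xi'.
  rewrite invariant_stationary lerBlDr -lerBlDl ler_pdivlMr //.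
  exact: mpow_ge_stationary.
have p0 := stationary_gt0 (stable_full A).
have := le_bigmax 0 (fun p => 1 - mpow P t p.1 p.2 / m p.2) (stable_empty A, stable_full A).
rewrite -/(d_sep P m t) /= mpow_full invariant_stationary mulfK ?gt_eqF //.
by rewrite opprB addrC subrK.
Qed.

Lemma d_tv_le_d_sep t : d_tv P m t <= d_sep P m t.
Proof.
rewrite d_sep_unfilled; apply: (d_tv_le arw_matrix_sum1 hm).
  by case/andP: (sigma01 t).
by move=> xi xi'; rewrite invariant_stationary; exact: mpow_ge_stationary.
Qed.

Lemma d_tv_ge (rho : R) : 0 <= rho -> (forall t, rho ^+ t <= d_sep P m t) ->
  forall t, rho ^+ t <= 2 * d_tv P m t.
Proof.
move=> rho0 rs t; rewrite leNgt; apply/negP => lt.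
have d0 := d_tv_ge0 P m t.
have rt0 : 0 < rho ^+ t by apply: le_lt_trans lt; lra.
have p0 := stationary_gt0 (stable_full A).
pose a := 2 * d_tv P m t / rho ^+ t.
have bnd k : stationary (stable_full A) <= a ^+ k.
  have rtk : 0 < (rho ^+ t) ^+ k by exact: exprn_gt0.
  rewrite expr_div_n ler_pdivlMr //.
  apply: le_trans (mpow_invariant_dist arw_matrix_sum1 hm t k (stable_full A) (stable_empty A)).
  rewrite mpow_full invariant_stationary -normrN opprB.
  apply: (le_trans _ (ler_norm _)); rewrite mulrBl mul1r opprB addrC subrK mulrC.
  by rewrite ler_pM2r // -exprM mulnC -d_sep_unfilled.
have a1 : `|a| < 1.
  by rewrite ger0_norm ?divr_ge0 ?(ltW rt0) ?mulr_ge0 // ltr_pdivrMr // mul1r.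
have /cvgr0Pnorm_lt /(_ _ p0) [k _ /(_ k (leqnn k)) /=] := cvg_expr a1.
by rewrite ltNge => /negP; apply; apply: le_trans (bnd k) (ler_norm _).
Qed.

Lemma d_sep_tail : exists mu L : R, chebyshev_tail (d_sep P m) mu L /\
  forall t, (1 - L^-1) ^+ t <= 2 * d_tv P m t.
Proof.
have [mu [L [tail rho]]] := unfilled_tail; exists mu, L; split.
  rewrite (_ : d_sep P m = fun t => sigma t) //.
  by apply/funext => t; exact: d_sep_unfilled.
have [L1 _ _ _] := tail; apply: d_tv_ge => [|t]; last by rewrite d_sep_unfilled.
by rewrite subr_ge0 invf_le1 // (lt_le_trans ltr01).
Qed.

Lemma d_sep_bounds t : 0 <= d_sep P m t <= 1.
Proof. by rewrite d_sep_unfilled. Qed.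

End Chain.

(** * Cutoff *)

Section CutoffWindow.
Variables (R : realType) (A : arw_params R) (m : stable_config A -> R).
Local Notation P := (@arw_matrix R A).
Hypothesis hm : invariant_distribution P m.
Variables mu L : R.
Hypothesis tail : chebyshev_tail (d_sep P m) mu L.
Local Notation tau := (half_time (d_sep P m)).
Local Notation tmix := (half_time (d_tv P m)).

Lemma half_time_bounds :
  tmix%:R <= 3 * mu /\ (tau%:R - mu) ^+ 2 <= 2 * ((L - 1) * mu).
Proof.
have [L1 Lmu up low] := tail.
pose t := Num.truncn (3 * mu).
have mu0 : 0 < mu by lra.
have t1 : t%:R <= 3 * mu by rewrite truncn_le; lra.
have t2 : 3 * mu < t.+1%:R := truncnS_gt _.
have dt : d_sep P m t <= 2^-1.
  have /andP[d0 _] := d_sep_bounds hm t.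
  have h := up t; move: t2 h; set T := t.+1%:R; set d := d_sep P m t in d0 * => t2 h.
  have {}h : d * (T - mu) ^+ 2 <= (L - 1) * mu by apply: h; lra.
  rewrite leNgt; apply/negP => dlt.
  have k1 : 4 * (mu * mu) <= (T - mu) ^+ 2 by nra.
  have k2 : 2^-1 * (T - mu) ^+ 2 <= d * (T - mu) ^+ 2.
    by rewrite ler_wpM2r ?sqr_ge0 // ltW.
  have k3 : (L - 1) * mu <= mu * mu by rewrite ler_wpM2r; lra.
  have : 0 < mu * mu by rewrite mulr_gt0.
  lra.
have [ds taut dlt] := half_timeP dt.

split.
  have [_ le _] := half_timeP (le_trans (d_tv_le_d_sep hm tau) ds).
  by apply: le_trans t1; rewrite ler_nat (leq_trans le).
have [le|gt] := leP tau%:R mu.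
  have h := low _ le; rewrite -sqrrN opprB.
  have k : 2^-1 * (mu - tau%:R) ^+ 2 <= (1 - d_sep P m tau) * (mu - tau%:R) ^+ 2.
    by rewrite ler_wpM2r ?sqr_ge0 //; lra.
  lra.
have tau0 : (0 < tau)%N by rewrite -(ltr_nat R); apply: lt_trans gt.
have lt1 : (tau.-1 < tau)%N by rewrite prednK.
have h := up tau.-1; rewrite prednK // in h.
have {}h := h (ltW gt); have d1 := dlt _ lt1.
have k : 2^-1 * (tau%:R - mu) ^+ 2 <= d_sep P m tau.-1 * (tau%:R - mu) ^+ 2.
  by rewrite ler_wpM2r ?sqr_ge0 // ltW.
lra.
Qed.

Lemma sep_cutoff_window (c alpha e : R) : 0 < c -> c <= 1 -> 0 <= alpha ->
  (L - 1) <= e * mu -> 2 * e <= c ^+ 2 ->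
  let t := Num.truncn (alpha * tau%:R) in
  (alpha * (1 + c) <= 1 - c -> 1 - d_sep P m t <= e / c ^+ 2) /\
  (1 + c <= alpha * (1 - c) -> d_sep P m t <= e / c ^+ 2).
Proof.
have [L1 Lmu up low] := tail.
move=> c0 c1 al0 Le ec t.
have mu0 : 0 < mu by lra.
have [_ htau] := half_time_bounds.
have hL : (L - 1) * mu <= e * mu ^+ 2 by rewrite expr2 mulrA ler_pM2r.
have hc : (tau%:R - mu) ^+ 2 <= (c * mu) ^+ 2.
  rewrite exprMn; apply: le_trans htau _.
  apply: le_trans (_ : 2 * e * mu ^+ 2 <= _); first lra.
  by rewrite ler_wpM2r ?sqr_ge0.
have cmu : 0 <= c * mu by rewrite mulr_ge0 // ltW.
have /andP[b1 b2] : - (c * mu) <= tau%:R - mu <= c * mu.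
  by rewrite -ler_norml -(ger0_norm cmu) -ler_sqr ?nnegrE // !real_normK ?num_real.
have t1 : t%:R <= alpha * tau%:R by rewrite truncn_le mulr_ge0.
have t2 : alpha * tau%:R < t.+1%:R := truncnS_gt _.
have /andP[d0 d1] := d_sep_bounds hm t.
have c2 : 0 < c ^+ 2 by rewrite exprn_gt0.
have mu2 : 0 < mu ^+ 2 by rewrite exprn_gt0.
have fin (u v : R) : 0 <= u -> c * mu <= v -> u * v ^+ 2 <= (L - 1) * mu -> u <= e / c ^+ 2.
  move=> u0 cv uv; rewrite ler_pdivlMr // -(ler_pM2r mu2).
  apply: le_trans hL; apply: le_trans uv; rewrite -mulrA ler_wpM2l // -exprMn.
  by rewrite ler_sqr ?nnegrE // (le_trans cmu).
split=> hal.
  have tm : c * mu <= mu - t%:R.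
    have k1 : alpha * tau%:R <= alpha * ((1 + c) * mu) by rewrite ler_wpM2l //; lra.
    have k2 : alpha * (1 + c) * mu <= (1 - c) * mu by rewrite ler_wpM2r // ltW.
    lra.
  by apply: (fin _ (mu - t%:R)) => //; [lra | apply: low; lra].
have tm : c * mu <= t.+1%:R - mu.
  have k1 : alpha * ((1 - c) * mu) <= alpha * tau%:R by rewrite ler_wpM2l //; lra.
  have k2 : (1 + c) * mu <= alpha * (1 - c) * mu by rewrite ler_wpM2r // ltW.
  lra.
by apply: (fin _ (t.+1%:R - mu)) => //; apply: up; lra.
Qed.

(* [1 - 1/L >= exp (- 1 / (L - 1))] turns the smallness of d_tv at time 2 tmix,
   which is at most 6 mu, into a lower bound on mu / (L - 1). *)
Lemma product_condition (e : R) : 0 < e ->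
  (forall t, (1 - L^-1) ^+ t <= 2 * d_tv P m t) ->
  2 * d_tv P m (2 * tmix) < expR (- (6 / e)) -> L - 1 <= e * mu.
Proof.
have [L1 Lmu up low] := tail.
move=> e0 rho small; rewrite leNgt; apply/negP => gt.
have mu0 : 0 < mu by lra.
have L0 : 0 < L - 1 by apply: lt_trans gt; rewrite mulr_gt0.
have [tm _] := half_time_bounds.
have r : expR (- (L - 1)^-1) <= 1 - L^-1.
  rewrite expRN.
  have -> : 1 - L^-1 = (1 + (L - 1)^-1)^-1.
    by field; apply/andP; split; rewrite gt_eqF //; lra.
  rewrite lef_pV2 ?posrE ?expR_gt0 ?expR_ge1Dx //.
  by rewrite addr_gt0 // invr_gt0.
have h : expR (- (6 / e)) <= (1 - L^-1) ^+ (2 * tmix).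
  apply: le_trans (_ : expR (- (L - 1)^-1) ^+ (2 * tmix) <= _); last first.
    by rewrite lerXn2r ?nnegrE ?expR_ge0 // (le_trans _ r) ?expR_ge0.
  rewrite -expRM_natl ler_expR mulrN lerN2 natrM.
  rewrite ler_pdivrMr // [leRHS]mulrC mulrA ler_pdivlMr //.
  have k : e * mu * 6 <= (L - 1) * 6 by rewrite ler_wpM2r // ltW.
  have k2 : 2 * tmix%:R * e <= 6 * mu * e by rewrite ler_wpM2r ?(ltW e0) //; lra.
  lra.
by have := le_lt_trans (le_trans h (rho _)) small; rewrite ltxx.
Qed.

End CutoffWindow.

Lemma d_tv_sep_window (R : realType) (A : arw_params R) (m : stable_config A -> R)
    (c alpha e : R) :
  invariant_distribution (@arw_matrix R A) m ->
  0 < c -> c <= 1 -> 0 <= alpha -> 0 < e -> 2 * e <= c ^+ 2 ->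
  2 * d_tv (@arw_matrix R A) m (2 * half_time (d_tv (@arw_matrix R A) m))
    < expR (- (6 / e)) ->
  let t := Num.truncn (alpha * (half_time (d_sep (@arw_matrix R A) m))%:R) in
  (alpha * (1 + c) <= 1 - c -> 1 - d_sep (@arw_matrix R A) m t <= e / c ^+ 2) /\
  (1 + c <= alpha * (1 - c) -> d_sep (@arw_matrix R A) m t <= e / c ^+ 2).
Proof.
move=> hm c0 c1 al0 e0 ec small; have [mu [L [tail rho]]] := d_sep_tail hm.
have Le := product_condition hm tail e0 rho small.
exact: (sep_cutoff_window hm tail c0 c1 al0 Le ec).
Qed.

Theorem corollary6 (R : realType) (A : nat -> arw_params R)
    (m : forall n : nat, stable_config (A n) -> R)
    (hm : forall n : nat,
        invariant_distribution (@arw_matrix R (A n)) (m n)) :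
  cutoff (fun n : nat => d_tv (@arw_matrix R (A n)) (m n)) ->
  cutoff (fun n : nat => d_sep (@arw_matrix R (A n)) (m n)).
Proof.
move=> tv_cutoff.
have window (alpha c del : R) : 0 <= alpha -> 0 < c -> c <= 1 -> 0 < del ->
    \forall n \near \oo,
    let t := Num.truncn (alpha * (half_time (d_sep (@arw_matrix R (A n)) (m n)))%:R) in
    (alpha * (1 + c) <= 1 - c -> 1 - d_sep (@arw_matrix R (A n)) (m n) t <= del) /\
    (1 + c <= alpha * (1 - c) -> d_sep (@arw_matrix R (A n)) (m n) t <= del).
  move=> al0 c0 c1 del0; have c2 : 0 < c ^+ 2 by rewrite exprn_gt0.
  pose e := Num.min (c ^+ 2 / 2) (del * c ^+ 2).
  have e0 : 0 < e by rewrite lt_min divr_gt0 // mulr_gt0.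
  have e1 : 2 * e <= c ^+ 2.
    have : e <= c ^+ 2 / 2 by rewrite ge_min lexx.
    lra.
  have e2 : e / c ^+ 2 <= del by rewrite ler_pdivrMr // ge_min lexx orbT.
  have e6 : 0 < expR (- (6 / e)) / 2 by rewrite divr_gt0 ?expR_gt0.
  have [_ /(_ (ltr1n _ 2)) /cvgr0Pnorm_lt /(_ _ e6)] := tv_cutoff 2 (ler0n _ 2).
  apply: filterS => n; rewrite -natrM natrK => small.
  have [|w1 w2] := d_tv_sep_window (hm n) c0 c1 al0 e0 e1.
    by have := le_lt_trans (ler_norm _) small; lra.
  by split=> [/w1 h|/w2 h]; exact: le_trans h e2.
move=> alpha al0; split=> al1.
- apply/cvgrPdist_le => del del0.
  pose c := (1 - alpha) / 2.
  have c0 : 0 < c by rewrite divr_gt0 // subr_gt0.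
  have c1 : c <= 1 by rewrite /c; lra.
  have := window alpha c del al0 c0 c1 del0; apply: filterS => n [w _].
  set t := Num.truncn _ in w *.
  rewrite ger0_norm; last by rewrite subr_ge0; case/andP: (d_sep_bounds (hm n) t).
  by apply: w; rewrite /c; nra.
- apply/cvgr0Pnorm_le => del del0.
  pose c := (alpha - 1) / (alpha + 1).
  have a1 : 0 < alpha + 1 by lra.
  have c0 : 0 < c by rewrite divr_gt0 // subr_gt0.
  have c1 : c <= 1 by rewrite ler_pdivrMr //; lra.
  have := window alpha c del al0 c0 c1 del0; apply: filterS => n [_ w].
  set t := Num.truncn _ in w *.
  rewrite ger0_norm; last by case/andP: (d_sep_bounds (hm n) t).
  apply: w; have ce : c * (alpha + 1) = alpha - 1 by rewrite /c divfK // gt_eqF.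
  lra.
Qed.
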